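(* Assume: $f=F\circ G$ is convex and $h$ is $\mu$-strongly convex with $\mu>0$; every $F_i$ is $L_F$-smooth with $B_F$-bounded gradient and every $G_j$ is $L_G$-smooth with $B_G$-bounded Jacobian; $\|[\nabla G_j(x)]^\top\nabla F_i(G(x))-[\nabla G_j(y)]^\top\nabla F_i(G(y))\|\le L\|x-y\|$ for all $i\in[n_1]$, $j\in[n_2]$ and $x,y\in\mathbb R^{N_2}$; and $L\ge\mu$. Let $x^*$ be the minimizer of $H=f+h$ and let $\varepsilon>0$. Run SoCK with Option II from $x_0$ with $$m=\left\lceil \tfrac12\sqrt{L/\mu}\right\rceil,\quad \tau_1=\tau_2=\frac1{2m},\quad \theta=1+\frac1{12m},\quad \alpha=\frac1{3\tau_1L},$$ $$A=\frac{2160B_G^4L_F^2}{\mu^2},\quad B=\frac{2160B_F^2L_G^2}{\mu^2},\quad C=\frac{1080L^2}{\mu^2}$$ ($A,B,C$ rounded up to the nearest positive integer). Then, with a suitable number $S$ of outer loops, the output $\widetilde x^S$ is a stochastic $\varepsilon$-solution, i.e. $\mathbb E[H(\widetilde x^S)-H(x^* )]\le\varepsilon$, and the total complexity is $$O\left(\Big(n_1+n_2+\sqrt{\frac L\mu}\,\frac{\max\{B_G^4L_F^2,\,B_F^2L_G^2,\,L^2\}}{\mu^2}\Big)\log\frac{H(x_0)-H(x^* )}{\varepsilon}\right),$$ where the constant in $O(\cdot)$ is universal.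
   Context: Problem: $\min_{x\in\mathbb R^{N_2}}H(x)=f(x)+h(x)$ with $f=F\circ G$, $F=\frac1{n_1}\sum_{i=1}^{n_1}F_i$, $G=\frac1{n_2}\sum_{j=1}^{n_2}G_j$, where $F_i:\mathbb R^{N_1}\to\mathbb R$ and $G_j:\mathbb R^{N_2}\to\mathbb R^{N_1}$ are differentiable and $h:\mathbb R^{N_2}\to\mathbb R\cup\{+\infty\}$ is a proper closed convex function. $\nabla$ denotes the gradient of a scalar function and the Jacobian matrix of a vector-valued map; $\|\cdot\|$ is the Euclidean norm of vectors and the spectral norm of matrices; $[n]=\{1,\dots,n\}$. A differentiable map $\phi$ is $l$-smooth if $\|\nabla\phi(x)-\nabla\phi(x')\|\le l\|x-x'\|$ for all $x,x'$; it has $b$-bounded gradient/Jacobian if $\|\nabla\phi(x)\|\le b$ for all $x$. $h$ is $\mu$-strongly convex if $h(x')\ge h(x)+\langle g,x'-x\rangle+\frac\mu2\|x'-x\|^2$ for every $x,x'$ and every subgradient $g$ of $h$ at $x$. Algorithm SoCK (Option II). Inputs: $x_0\in\mathbb R^{N_2}$ with $h(x_0)<\infty$, positive integers $S,m,A,B,C$, reals $\theta>1$, $\alpha>0$, $\tau_1,\tau_2$. Set $y_0=z_0=\widetilde x^0=x_0$. For $s=0,\dots,S-1$: compute $G(\widetilde x^s)$, $\nabla G(\widetilde x^s)$, $\nabla f(\widetilde x^s)$; for $j=0,\dots,m-1$, put $k=sm+j$ and (1) $x_{k+1}=\tau_1z_k+\tau_2\widetilde x^s+(1-\tau_1-\tau_2)y_k$;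 (2) draw multisets $\mathcal A_k,\mathcal B_k$ from $[n_2]$ and $\mathcal C_k$ from $[n_1]$, uniformly at random with replacement, with $|\mathcal A_k|=A$, $|\mathcal B_k|=B$, $|\mathcal C_k|=C$ (all draws mutually independent); (3) $\widehat G_k=\frac1A\sum_{i\in\mathcal A_k}(G_i(x_{k+1})-G_i(\widetilde x^s))+G(\widetilde x^s)$ and $\nabla\widehat G_k=\frac1B\sum_{i\in\mathcal B_k}(\nabla G_i(x_{k+1})-\nabla G_i(\widetilde x^s))+\nabla G(\widetilde x^s)$; (4) $\widetilde\nabla_{k+1}=\frac1C\sum_{i\in\mathcal C_k}\big([\nabla\widehat G_k]^\top\nabla F_i(\widehat G_k)-[\nabla G(\widetilde x^s)]^\top\nabla F_i(G(\widetilde x^s))\big)+\nabla f(\widetilde x^s)$; (5) $z_{k+1}=\arg\min_z\{\langle\widetilde\nabla_{k+1},z\rangle+\frac1{2\alpha}\|z-z_k\|^2+h(z)\}$; (6) $y_{k+1}=\arg\min_y\{\langle\widetilde\nabla_{k+1},y\rangle+\frac{3L}2\|y-x_{k+1}\|^2+h(y)\}$. After the inner loop, $\widetilde x^{s+1}=\big(\sum_{j=0}^{m-1}\theta^j\big)^{-1}\sum_{j=0}^{m-1}\theta^jy_{sm+j+1}$. The output is $\widetilde x^S$. Complexity is the total number of evaluations of the component quantities $\nabla F_i$, $G_j$, $\nabla G_j$ and of the proximal mapping of $h$ (steps (5), (6) use one each). Per outer loop, the component evaluations number $n_1+2n_2+2m(A+B+C)$. In the complexity bound, $\log(\cdot)$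 is read as $\max\{1,\log(\cdot)\}$. *)

(* Defs.v *)
From HB Require Import structures.
From mathcomp Require Import all_boot all_order all_algebra.
From mathcomp Require Import all_classical all_reals all_analysis.

Set Implicit Arguments.
Unset Strict Implicit.
Unset Printing Implicit Defensive.

Import Order.TTheory GRing.Theory Num.Theory.
Import numFieldNormedType.Exports.

Local Open Scope classical_set_scope.
Local Open Scope ring_scope.

(* Vectors of R^N are row vectors 'rV[R]_N.  The norm that the library puts on
   'rV[R]_N is the sup norm; it only serves to express differentiability and
   topology.  The Euclidean norm is enorm below. *)

Section Euclidean.
Variable R : realType.

Definition dot N (u v : 'rV[R]_N) : R := \sum_(i < N) u 0 i * v 0 i.

Definition enorm N (u : 'rV[R]_N) : R := Num.sqrt (dot u u).

(* [v *m M^T] is the row form of the column [M v]. *)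
Definition specnorm p q (M : 'M[R]_(p, q)) : R :=
  sup [set enorm (v *m M^T) | v in [set v : 'rV[R]_q | enorm v <= 1]].

Definition gradient N (f : 'rV[R]_N -> R) (x : 'rV[R]_N) : 'rV[R]_N :=
  \row_i 'D_(delta_mx 0 i) f x.

(* The library's [jacobian] acts on row vectors from the right, hence it is the
   transpose of the Jacobian matrix whose (i, j) entry is the j-th partial
   derivative of the i-th component. *)
Definition Jac N M (g : 'rV[R]_N -> 'rV[R]_M) (x : 'rV[R]_N) : 'M[R]_(M, N) :=
  ('J g x)^T.

Definition smooth_fun N (l : R) (f : 'rV[R]_N -> R) : Prop :=
  forall x x', enorm (gradient f x - gradient f x') <= l * enorm (x - x').

Definition smooth_map N M (l : R) (g : 'rV[R]_N -> 'rV[R]_M) : Prop :=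
  forall x x', specnorm (Jac g x - Jac g x') <= l * enorm (x - x').

Definition bounded_gradient N (b : R) (f : 'rV[R]_N -> R) : Prop :=
  forall x, enorm (gradient f x) <= b.

Definition bounded_Jac N M (b : R) (g : 'rV[R]_N -> 'rV[R]_M) : Prop :=
  forall x, specnorm (Jac g x) <= b.

End Euclidean.

Section Convex.
Variables (R : realType) (N : nat).
Implicit Types h phi : 'rV[R]_N -> \bar R.

Local Open Scope ereal_scope.

Definition proper_fun h : Prop :=
  (forall x, h x != -oo) /\ (exists x, h x < +oo).

Definition closed_fun h : Prop :=
  closed [set p : 'rV[R]_N * R | h p.1 <= p.2%:E].

Definition convex_efun h : Prop :=
  forall (t : R) x y, (0 <= t <= 1)%R ->
    h (t *: x + (1 - t) *: y)%R <= t%:E * h x + (1 - t)%:E * h y.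

Definition subgradient h (x g : 'rV[R]_N) : Prop :=
  forall x', h x + (dot g (x' - x))%:E <= h x'.

Definition strongly_convex (mu : R) h : Prop :=
  forall x x' g, subgradient h x g ->
    h x + (dot g (x' - x) + mu / 2 * enorm (x' - x) ^+ 2)%:E <= h x'.

Definition is_minimizer phi (z : 'rV[R]_N) : Prop := forall z', phi z <= phi z'.

(* A chosen minimizer; only meaningful when phi has one. *)
Definition argmin phi : 'rV[R]_N := get [set z | is_minimizer phi z].

End Convex.

Section Problem.
Variables (R : realType) (N1 N2 n1 n2 : nat).
Variables (F : 'I_n1 -> 'rV[R]_N1 -> R) (G : 'I_n2 -> 'rV[R]_N2 -> 'rV[R]_N1).
Variable h : 'rV[R]_N2 -> \bar R.

Definition Favg (y : 'rV[R]_N1) : R := n1%:R^-1 * \sum_(i < n1) F i y.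

Definition Gavg (x : 'rV[R]_N2) : 'rV[R]_N1 := n2%:R^-1 *: \sum_(j < n2) G j x.

Definition fcomp (x : 'rV[R]_N2) : R := Favg (Gavg x).

Definition Hobj (x : 'rV[R]_N2) : \bar R := ((fcomp x)%:E + h x)%E.

End Problem.

(* The multisets A_k, B_k, C_k drawn at one inner iteration, as sequences of
   independent draws with replacement. *)
Definition draw (n1 n2 A B C : nat) : finType :=
  (A.-tuple 'I_n2 * B.-tuple 'I_n2 * C.-tuple 'I_n1)%type.

(* All the draws of a run with S outer loops of length m.  The uniform
   distribution on this finite type is exactly the joint law of mutually
   independent uniform draws. *)
Definition run_draws (n1 n2 A B C m S : nat) : finType :=
  S.-tuple (m.-tuple (draw n1 n2 A B C)).

Definition unif_expectation (R : realType) (T : finType) (X : T -> \bar R) :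
  \bar R := ((#|T|%:R^-1)%:E * \sum_(w : T) X w)%E.

Section SoCK.
Variables (R : realType) (N1 N2 n1 n2 : nat).
Variables (F : 'I_n1 -> 'rV[R]_N1 -> R) (G : 'I_n2 -> 'rV[R]_N2 -> 'rV[R]_N1).
Variable h : 'rV[R]_N2 -> \bar R.
Variables (L theta alpha tau1 tau2 : R) (m A B C : nat).

Local Notation V := 'rV[R]_N2.

Definition Ghat (a : A.-tuple 'I_n2) (xt x : V) : 'rV[R]_N1 :=
  A%:R^-1 *: \sum_(i <- a) (G i x - G i xt) + Gavg G xt.

Definition Jhat (b : B.-tuple 'I_n2) (xt x : V) : 'M[R]_(N1, N2) :=
  B%:R^-1 *: \sum_(i <- b) (Jac (G i) x - Jac (G i) xt) + Jac (Gavg G) xt.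

(* Row form: [g *m J] is the transpose of the column [J^T g]. *)
Definition grad_est (d : draw n1 n2 A B C) (xt x : V) : V :=
  let: (a, b, c) := d in
  C%:R^-1 *: \sum_(i <- c)
      (gradient (F i) (Ghat a xt x) *m Jhat b xt x
       - gradient (F i) (Gavg G xt) *m Jac (Gavg G) xt)
  + gradient (fcomp F G) xt.

(* One inner iteration: the state is the pair (y_k, z_k). *)
Definition inner_step (xt : V) (yz : V * V) (d : draw n1 n2 A B C) : V * V :=
  let: (y, z) := yz in
  let x := tau1 *: z + tau2 *: xt + (1 - tau1 - tau2) *: y in
  let g := grad_est d xt x in
  (argmin (fun y' : V =>
     (dot g y' + 3 * L / 2 * enorm (y' - x) ^+ 2)%:E + h y')%E,
   argmin (fun z' : V =>
     (dot g z' + (2 * alpha)^-1 * enorm (z' - z) ^+ 2)%:E + h z')%E).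

(* One outer loop: the state is (xt, (y, z)); the j-th item of the scan is
   (y_{sm+j+1}, z_{sm+j+1}).  Note that y and z are not reset. *)
Definition outer_step (st : V * (V * V)) (ds : m.-tuple (draw n1 n2 A B C)) :
    V * (V * V) :=
  let: (xt, yz) := st in
  let path := scanl (inner_step xt) yz ds in
  ((\sum_(j < m) theta ^+ j)^-1 *:
     \sum_(j < m) theta ^+ j *: (nth yz path j).1,
   last yz path).

Definition sock S (x0 : V) (w : run_draws n1 n2 A B C m S) : V :=
  (foldl outer_step (x0, (x0, x0)) w).1.

End SoCK.

(* Each outer loop evaluates all G_j, grad G_j, grad F_i at the snapshot; each
   inner iteration evaluates the sampled G_i, grad G_i, grad F_i at two points
   each, and the proximal mapping of h twice. *)
Definition sock_complexity (n1 n2 m A B C S : nat) : nat :=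
  (\sum_(s < S) (n1 + 2 * n2 + \sum_(j < m) (2 * (A + B + C) + 2)))%N.

(* Intended for r >= 0. *)
Definition ceiln (R : realType) (r : R) : nat := absz (Num.ceil r).

(* Main.v *)
Require Import Defs.
From HB Require Import structures.
From mathcomp Require Import all_boot all_order all_algebra.
From mathcomp Require Import all_classical all_reals all_analysis.
From mathcomp Require Import ring lra.

(** Write a(u) for H(u) - H(x_star) and d(u) for the squared distance from u to
    x_star.  The error of the gradient estimator splits into three sampling
    errors, so its mean square is at most mu^2/180 times the squared distance
    from x_(k+1) to the snapshot; no unbiasedness is needed, because the bias is
    absorbed by Young's inequality into a fraction of the strong convexity.
    Coupling the two proximal steps then gives, in mean over one draw and with
    tau = tau1 = tau2,

      a(y') + theta gam d(z') <=
        17/16 tau a(xt) + (1 - 31/16 tau) a(y) + gam d(z).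

    Weighting these inequalities by theta^j over the inner loop, and using the
    convexity of H on the weighted average, a potential that combines a(xt),
    a(y) and d(z) contracts in mean by theta^(-m) <= 12/13 per outer loop.
    All differentiability is used through quadratic upper models, so optimality
    conditions need no limits; the minimizer x_star provides the affine minorant
    of h which makes the proximal problems solvable. *)

Set Implicit Arguments.
Unset Strict Implicit.
Unset Printing Implicit Defensive.

Import Order.TTheory GRing.Theory Num.Theory.
Import numFieldNormedType.Exports.

Local Open Scope classical_set_scope.
Local Open Scope ring_scope.

(** * Euclidean inner product and norm on row vectors *)

Section EuclideanSpace.
Context {R : realType} {N : nat}.
Implicit Types (u v w : 'rV[R]_N) (a b k : R).

Lemma dotC u v : dot u v = dot v u.
Proof. by apply: eq_bigr => i _; rewrite mulrC. Qed.

Lemma dotDl u v w : dot (u + v) w = dot u w + dot v w.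
Proof. by rewrite -big_split; apply: eq_bigr => i _; rewrite mxE mulrDl. Qed.

Lemma dotZl a u v : dot (a *: u) v = a * dot u v.
Proof. by rewrite mulr_sumr; apply: eq_bigr => i _; rewrite mxE mulrA. Qed.

Lemma dotNl u v : dot (- u) v = - dot u v.
Proof. by rewrite -scaleN1r dotZl mulN1r. Qed.

Lemma dotDr u v w : dot w (u + v) = dot w u + dot w v.
Proof. by rewrite !(dotC w) dotDl. Qed.

Lemma dotZr a u v : dot v (a *: u) = a * dot v u.
Proof. by rewrite !(dotC v) dotZl. Qed.

Lemma dotNr u v : dot v (- u) = - dot v u.
Proof. by rewrite !(dotC v) dotNl. Qed.

Lemma dot0l v : dot 0 v = 0.
Proof. by rewrite -(scale0r v) dotZl mul0r. Qed.

Lemma dot0r v : dot v 0 = 0.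
Proof. by rewrite dotC dot0l. Qed.

Definition dotE := (dotDl, dotDr, dotZl, dotZr, dotNl, dotNr, dot0l, dot0r).

Lemma dot_suml I (r : seq I) (P : pred I) (f : I -> 'rV[R]_N) v :
  dot (\sum_(i <- r | P i) f i) v = \sum_(i <- r | P i) dot (f i) v.
Proof.
by apply: (big_morph (fun u => dot u v)); [move=> ? ?; exact: dotDl | exact: dot0l].
Qed.

Lemma dot_sumr I (r : seq I) (P : pred I) (f : I -> 'rV[R]_N) v :
  dot v (\sum_(i <- r | P i) f i) = \sum_(i <- r | P i) dot v (f i).
Proof. by rewrite dotC dot_suml; apply: eq_bigr => i _; rewrite dotC. Qed.

Lemma dot_ge0 u : 0 <= dot u u.
Proof. by apply: sumr_ge0 => i _; rewrite -expr2 sqr_ge0. Qed.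

Lemma enorm_ge0 u : 0 <= enorm u.
Proof. exact: sqrtr_ge0. Qed.

Lemma enorm_sqr u : enorm u ^+ 2 = dot u u.
Proof. by rewrite sqr_sqrtr // dot_ge0. Qed.

Lemma dot_eq0 u : dot u u = 0 -> u = 0.
Proof.
move=> /eqP; rewrite psumr_eq0; last by move=> i _; rewrite -expr2 sqr_ge0.
move=> /allP uu0; apply/rowP => i; rewrite mxE.
by move: (uu0 i (mem_index_enum _)); rewrite /= mulf_eq0 orbb => /eqP.
Qed.

Lemma enormZ a u : enorm (a *: u) = `|a| * enorm u.
Proof.
by rewrite /enorm !dotE mulrA -expr2 sqrtrM ?sqr_ge0 // sqrtr_sqr.
Qed.

Lemma enormN u : enorm (- u) = enorm u.
Proof. by rewrite /enorm !dotE opprK. Qed.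

Lemma enorm0 : enorm (0 : 'rV[R]_N) = 0.
Proof. by rewrite /enorm dot0l sqrtr0. Qed.

Lemma enorm_le_sqr u b : 0 <= b -> dot u u <= b ^+ 2 -> enorm u <= b.
Proof.
by move=> b0 ub; rewrite -(@ler_pXn2r _ 2) ?nnegrE ?enorm_ge0 // enorm_sqr.
Qed.

Lemma dot_le_sqr u b : enorm u <= b -> dot u u <= b ^+ 2.
Proof.
move=> ub; rewrite -enorm_sqr ler_pXn2r ?nnegrE ?enorm_ge0 //.
exact: le_trans (enorm_ge0 u) ub.
Qed.

(** Expanding the squared norm of [dot v v *: u - dot u v *: v], a multiple of the component of u
    orthogonal to v, gives the claim multiplied by |v|^2. *)
Lemma dot_sqr_le u v : dot u v ^+ 2 <= dot u u * dot v v.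
Proof.
have [v0|vN0] := eqVneq (dot v v) 0.
  by rewrite (dot_eq0 v0) !dotE expr0n /= mulr0.
have vgt0 : 0 < dot v v by rewrite lt_neqAle eq_sym vN0 dot_ge0.
have := dot_ge0 (dot v v *: u - dot u v *: v).
rewrite !dotE (dotC v u) => H.
have : 0 <= dot v v * (dot u u * dot v v - dot u v ^+ 2).
  by apply: le_trans H _; rewrite le_eqVlt; apply/orP; left; apply/eqP; ring.
by rewrite pmulr_rge0 // subr_ge0.
Qed.

Lemma CauchySchwarz_dot u v : `|dot u v| <= enorm u * enorm v.
Proof.
rewrite -(@ler_pXn2r _ 2) ?nnegrE ?mulr_ge0 ?enorm_ge0 // exprMn !enorm_sqr.
by rewrite real_normK ?num_real // dot_sqr_le.
Qed.

Lemma dot_le_enorm u v : dot u v <= enorm u * enorm v.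
Proof. exact: le_trans (ler_norm _) (CauchySchwarz_dot u v). Qed.

Lemma ler_enormD u v : enorm (u + v) <= enorm u + enorm v.
Proof.
apply: enorm_le_sqr; first by rewrite addr_ge0 ?enorm_ge0.
rewrite !dotE sqrrD !enorm_sqr (dotC v u) -mulr_natl.
by have := dot_le_enorm u v; lra.
Qed.

Lemma ler_enorm_sum I (r : seq I) (f : I -> 'rV[R]_N) :
  enorm (\sum_(i <- r) f i) <= \sum_(i <- r) enorm (f i).
Proof.
elim: r => [|i r IH]; first by rewrite !big_nil enorm0.
by rewrite !big_cons; apply: le_trans (ler_enormD _ _) _; rewrite lerD2l.
Qed.

Lemma enorm_mean_le I (r : seq I) (f : I -> 'rV[R]_N) b : 0 <= b ->
  (forall i, enorm (f i) <= b) -> enorm ((size r)%:R^-1 *: \sum_(i <- r) f i) <= b.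
Proof.
move=> b0 fb; rewrite enormZ ger0_norm ?invr_ge0 ?ler0n //.
(* For an empty list the inverse of 0 is 0, so the mean is 0. *)
have [->|r0] := eqVneq (size r) 0%N; first by rewrite invr0 mul0r.
rewrite ler_pdivrMl ?ltr0n ?lt0n //; apply: le_trans (ler_enorm_sum _ _) _.
apply: (le_trans (y := \sum_(i <- r) b)); first by apply: ler_sum => i _; exact: fb.
by rewrite big_const_seq count_predT iter_addr_0 mulr_natl.
Qed.

(** This is |u - k v|^2 >= 0 divided by 2k. *)
Lemma dot_young k u v : 0 < k -> dot u v <= dot u u / (2 * k) + k / 2 * dot v v.
Proof.
move=> k0; have := dot_ge0 (u - k *: v); rewrite !dotE (dotC v u) => H.
rewrite -(@ler_pM2l _ (2 * k)) ?mulr_gt0 //.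
have -> : 2 * k * (dot u u / (2 * k) + k / 2 * dot v v) =
    dot u u + k ^+ 2 * dot v v by field; rewrite gt_eqF.
by rewrite expr2; lra.
Qed.

Lemma dot_sqrD_le2 u v : dot (u + v) (u + v) <= 2 * dot u u + 2 * dot v v.
Proof. by have := dot_ge0 (u - v); rewrite !dotE (dotC v u); lra. Qed.

End EuclideanSpace.

(** * The spectral norm as an operator norm *)

Section SpectralNorm.
Context {R : realType} {p q : nat}.
Implicit Types (M : 'M[R]_(p, q)).

Lemma dot_mulmx (g : 'rV[R]_p) M (v : 'rV[R]_q) : dot (g *m M) v = dot g (v *m M^T).
Proof.
rewrite /dot; under eq_bigr => i _ do rewrite mxE mulr_suml.
rewrite exchange_big; apply: eq_bigr => j _; rewrite mxE mulr_sumr.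
by apply: eq_bigr => i _; rewrite mxE -mulrA (mulrC (M _ _)).
Qed.

Let specset M := [set enorm (v *m M^T) | v in [set v : 'rV[R]_q | enorm v <= 1]].

(** A [sup] is meaningful only for a nonempty bounded set; here the Frobenius norm is an upper
    bound, by Cauchy-Schwarz on each row. *)
Lemma specnorm_has_sup M : has_sup (specset M).
Proof.
split; first by exists 0; exists 0; rewrite /= ?mul0mx ?enorm0.
pose b := \sum_(i < p) enorm (row i M) ^+ 2.
have b0 : 0 <= b by apply: sumr_ge0 => i _; rewrite sqr_ge0.
exists (Num.sqrt b) => _ [v v1 <-]; apply: enorm_le_sqr; first exact: sqrtr_ge0.
rewrite sqr_sqrtr // /dot; apply: ler_sum => i _.
have -> : (v *m M^T) 0 i = dot v (row i M).
  by rewrite mxE; apply: eq_bigr => j _; rewrite !mxE.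
rewrite -expr2; apply: le_trans (dot_sqr_le _ _) _; rewrite -!enorm_sqr.
rewrite ler_piMl ?sqr_ge0 //.
by rewrite -(expr1n _ 2) ler_pXn2r ?nnegrE ?enorm_ge0.
Qed.

Lemma specnorm_ge0 M : 0 <= specnorm M.
Proof.
apply: (ub_le_sup (specnorm_has_sup M).2).
by exists 0; rewrite /= ?mul0mx ?enorm0.
Qed.

Lemma enorm_mulmx_tr_le M (v : 'rV[R]_q) : enorm (v *m M^T) <= specnorm M * enorm v.
Proof.
have [v0|vN0] := eqVneq (enorm v) 0.
  have -> : v = 0 by apply: dot_eq0; rewrite -enorm_sqr v0 expr0n.
  by rewrite mul0mx !enorm0 mulr0.
have vgt0 : 0 < enorm v by rewrite lt_neqAle eq_sym vN0 enorm_ge0.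
rewrite -ler_pdivrMr // mulrC.
apply: (ub_le_sup (specnorm_has_sup M).2).
have vV : `|(enorm v)^-1| = (enorm v)^-1 by rewrite ger0_norm // invr_ge0 enorm_ge0.
exists ((enorm v)^-1 *: v) => /=; first by rewrite enormZ vV mulVf.
by rewrite -scalemxAl enormZ vV.
Qed.

(** Duality: |g M|^2 is the product of g with [(g *m M) *m M^T], so the bound for the transpose
    applies and one factor |g M| cancels. *)
Lemma enorm_mulmx_le M (g : 'rV[R]_p) : enorm (g *m M) <= specnorm M * enorm g.
Proof.
have [->|gN0] := eqVneq (enorm (g *m M)) 0.
  by rewrite mulr_ge0 ?specnorm_ge0 ?enorm_ge0.
have ggt0 : 0 < enorm (g *m M) by rewrite lt_neqAle eq_sym gN0 enorm_ge0.
rewrite -(@ler_pM2r _ (enorm (g *m M))) // -expr2 enorm_sqr dot_mulmx.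
apply: le_trans (dot_le_enorm _ _) _; rewrite mulrAC mulrC.
by rewrite ler_wpM2r ?enorm_ge0 // enorm_mulmx_tr_le.
Qed.

End SpectralNorm.

(** * Gradients, Jacobians and mean value estimates along segments *)

Section Gradient.
Context {R : realType}.

(** The product with u as a map into the normed module [R^o], so that it can be declared linear and
    differentiated. *)
Definition dotr N (u v : 'rV[R]_N) : R^o := dot v u.

Fact dotr_is_linear N (u : 'rV[R]_N) : linear (dotr u).
Proof. by move=> a v w; rewrite /dotr !dotE. Qed.
HB.instance Definition _ N (u : 'rV[R]_N) :=
  GRing.isLinear.Build R 'rV[R]_N R^o *:%R (dotr u) (dotr_is_linear u).

Lemma dot_continuous N (u : 'rV[R]_N) : continuous (fun v => dot v u).
Proof.
rewrite /dot; apply: continuous_big => [|i _ x]; first exact: add_continuous.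
by apply: cvgMr_tmp; [exact: nbhs_filter | exact: coord_continuous].
Qed.

Lemma dot_self_continuous N : continuous (fun v : 'rV[R]_N => dot v v).
Proof.
rewrite /dot; apply: continuous_big => [|i _ x]; first exact: add_continuous.
by apply: cvgM; [exact: nbhs_filter | exact: coord_continuous | exact: coord_continuous].
Qed.

Lemma is_derive_line N (W : normedModType R) (f : 'rV[R]_N -> W) x d (t : R) :
  differentiable f (x + t *: d) ->
  is_derive t 1 (fun s : R => f (x + s *: d)) ('d f (x + t *: d) d).
Proof.
move=> df; pose l (s : R) : 'rV[R]_N := x + s *: d.
have dl : is_diff t l ( *:%R^~ d).
  by rewrite -[X in is_diff _ _ X]add0r; apply: is_diffD.
have dl' : differentiable l t by [].
have dlE : 'd l t = *:%R^~ d :> (R -> _) by apply: diff_val.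
have dc : differentiable (f \o l) t by apply: differentiable_comp.
apply: DeriveDef; first exact: diff_derivable.
by rewrite deriveE // diff_comp //= dlE scale1r.
Qed.

Lemma diff_gradient N (f : 'rV[R]_N -> R) x v :
  differentiable f x -> 'd f x v = dot (gradient f x) v :> R.
Proof.
move=> df; rewrite {1}(row_sum_delta v) linear_sum /dot; apply: eq_bigr => i _.
by rewrite linearZ /= /gradient mxE deriveE // mulrC.
Qed.

Lemma diff_Jac N M (g : 'rV[R]_N -> 'rV[R]_M) x v :
  differentiable g x -> 'd g x v = v *m (Jac g x)^T.
Proof. by move=> dg; rewrite /Jac trmxK /jacobian mul_rV_lin1. Qed.

Lemma gradient_eq N (f : 'rV[R]_N -> R) x g : differentiable f x ->
  (forall v, 'd f x v = dot g v) -> gradient f x = g.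
Proof.
move=> df dfg; apply/eqP; rewrite -subr_eq0; apply/eqP/dot_eq0.
by rewrite dotDl dotNl -dfg -diff_gradient // subrr.
Qed.

(* Upper quadratic model of a smooth function; applied to [- f] it also gives
   the lower one. *)
Lemma smooth_upper N (f : 'rV[R]_N -> R) (L : R) (x d : 'rV[R]_N) :
  (forall x, differentiable f x) ->
  (forall x y, enorm (gradient f x - gradient f y) <= L * enorm (x - y)) ->
  f (x + d) <= f x + dot (gradient f x) d + L / 2 * dot d d.
Proof.
move=> df fL.
(* The excess of f over its quadratic model along the segment; its derivative is nonpositive on ]0,
   1[, so the mean value theorem gives phi 1 <= phi 0. *)
pose phi (t : R) : R := f (x + t *: d) - t * dot (gradient f x) d
  - t ^+ 2 * (L / 2 * dot d d).
pose dphi (t : R) : R := dot (gradient f (x + t *: d)) d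
  - dot (gradient f x) d - t * (L * dot d d).
have dphiP (t : R) : is_derive t 1 phi (dphi t).
  have := is_derive_line (df (x + t *: d)) => H.
  rewrite diff_gradient // in H.
  apply: is_derive_eq.
  rewrite /dphi /GRing.scale /=; lra.
have phic : {within `[(0:R), 1], continuous phi}.
  by apply: derivable_within_continuous => t _; case: (dphiP t).
have [t t01] := MVT (@ltr01 R) (fun t _ => dphiP t) phic.
have dphit : dphi t <= 0.
  move: t01; rewrite in_itv /= => /andP[t0 _].
  have := dot_le_enorm (gradient f (x + t *: d) - gradient f x) d.
  have := fL (x + t *: d) x.
  rewrite [x + _ - x]addrAC subrr add0r enormZ gtr0_norm // => H1 H2.
  have : enorm (gradient f (x + t *: d) - gradient f x) * enorm d
     <= L * (t * enorm d) * enorm d by rewrite ler_wpM2r ?enorm_ge0.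
  rewrite !dotE in H2; rewrite /dphi -enorm_sqr; move: H2; lra.
rewrite /phi subr0 mulr1 scale1r scale0r addr0 expr0n /= !mul0r !subr0 expr1n !mul1r.
by move=> H; lra.
Qed.

(** The mean value theorem is scalar, so it is applied to the product of g with the fixed vector u =
    g x - g y; one factor |u| then cancels. *)
Lemma bounded_Jac_lipschitz N M (g : 'rV[R]_N -> 'rV[R]_M) (b : R) x y :
  (forall x, differentiable g x) -> bounded_Jac b g ->
  enorm (g x - g y) <= b * enorm (x - y).
Proof.
move=> dg gb; set u := g x - g y; set d := x - y.
pose phi (t : R) : R := dotr u (g (y + t *: d)).
pose dphi (t : R) : R := dot (d *m (Jac g (y + t *: d))^T) u.
have dphiP (t : R) : is_derive t 1 phi (dphi t).
  have cu : {for g (y + t *: d), continuous (dotr u)} by apply: dot_continuous.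
  have cu' : continuous (dotr u) by apply: dot_continuous.
  have du : differentiable (dotr u) (g (y + t *: d)) by exact: linear_differentiable.
  have -> : dphi t = 'd (dotr u \o g) (y + t *: d) d.
    by rewrite diff_comp //= diff_lin // diff_Jac.
  apply: (@is_derive_line _ _ (dotr u \o g)); exact: differentiable_comp.
have phic : {within `[(0:R), 1], continuous phi}.
  by apply: derivable_within_continuous => t _; case: (dphiP t).
have [t _] := MVT (@ltr01 R) (fun t _ => dphiP t) phic.
rewrite /phi subr0 mulr1 scale1r scale0r addr0 /dotr (addrC y) subrK.
rewrite -dotNl -dotDl -/u -enorm_sqr => uE.
have [u0|uN0] := eqVneq (enorm u) 0.
  by rewrite u0 mulr_ge0 ?enorm_ge0 // (le_trans (specnorm_ge0 (Jac g x))).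
have ugt0 : 0 < enorm u by rewrite lt_neqAle eq_sym uN0 enorm_ge0.
rewrite -(@ler_pM2r _ (enorm u)) // -expr2 uE.
apply: le_trans (dot_le_enorm _ _) _; rewrite ler_wpM2r ?enorm_ge0 //.
by apply: le_trans (enorm_mulmx_tr_le _ _) _; rewrite ler_wpM2r ?enorm_ge0.
Qed.

End Gradient.

(** * Proper convex functions: finite values, subgradients, optimality *)

Section ProperConvex.
Context {R : realType} {N : nat}.
Variable h : 'rV[R]_N -> \bar R.
Hypothesis hproper : proper_fun h.
Implicit Types (u v w z g p : 'rV[R]_N).

Let dom u := (h u < +oo)%E.
Let hr u := fine (h u).

Lemma proper_fineK u : (h u < +oo)%E -> h u = (fine (h u))%:E.
Proof.
by move=> hu; rewrite fineK // fin_numE hproper.1 lt_eqF.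
Qed.

Lemma ltey_of_leEFin u (r : R) : (h u <= r%:E)%E -> (h u < +oo)%E.
Proof. by move=> hur; apply: le_lt_trans hur _; exact: ltry. Qed.

Hypothesis hconvex : convex_efun h.

Lemma convex_fine (t : R) u v : dom u -> dom v -> 0 <= t -> t <= 1 ->
  dom (t *: u + (1 - t) *: v) /\
  hr (t *: u + (1 - t) *: v) <= t * hr u + (1 - t) * hr v.
Proof.
move=> du dv t0 t1; have := @hconvex t u v; rewrite t0 t1 => /(_ isT).
rewrite (proper_fineK du) (proper_fineK dv) -!EFinM -EFinD => H.
have d := ltey_of_leEFin H; split=> //.
by move: H; rewrite (proper_fineK d) lee_fin.
Qed.

(** Replaces the passage to the limit t -> 0 in difference quotients: for each e > 0 an explicit t
    makes t k at most e. *)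
Lemma linear_perturbation_ge0 (c k : R) :
  (forall t, 0 < t -> t <= 1 -> 0 <= c + t * k) -> 0 <= c.
Proof.
move=> H; apply/ler_addgt0Pr => e e0.
pose t := Num.min 1 (e / (`|k| + 1)).
have k0 : 0 < `|k| + 1 by rewrite ltr_wpDl.
have t0 : 0 < t by rewrite /t lt_min ltr01 divr_gt0.
have t1 : t <= 1 by rewrite /t ge_min lexx.
apply: le_trans (H t t0 t1) _; rewrite lerD2l.
apply: le_trans (ler_norm _) _; rewrite normrM gtr0_norm //.
apply: (le_trans (y := t * (`|k| + 1))); first by rewrite ler_pM2l // lerDl.
by rewrite -ler_pdivlMr // /t ge_min lexx orbT.
Qed.

(* First-order optimality for [h + q], where the differentiability of [q] at
   [z] only enters through a quadratic upper model. *)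
Lemma subgradient_of_min (q : 'rV[R]_N -> R) z v (k : R) : dom z ->
  (forall u, dom u -> hr z + q z <= hr u + q u) ->
  (forall d, q (z + d) <= q z + dot v d + k * dot d d) ->
  subgradient h z (- v).
Proof.
move=> dz zmin qup u.
have [du|] := boolP (h u < +oo)%E; last first.
  by rewrite ltey negbK => /eqP ->; rewrite leey.
rewrite (proper_fineK dz) (proper_fineK du) -EFinD lee_fin -subr_ge0.
set d := u - z; apply: (@linear_perturbation_ge0 _ (k * dot d d)) => t t0 t1.
have [dt ht] := convex_fine du dz (ltW t0) t1.
have := zmin _ dt; have E : t *: u + (1 - t) *: z = z + t *: d.
  by rewrite scalerBl scale1r /d scalerBr addrCA.
rewrite E in dt ht *; have := qup (t *: d); rewrite !dotE => H1 H2.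
rewrite -(@pmulr_rge0 _ t) //.
move: ht H1 H2; rewrite -/(hr z) -/(hr u); lra.
Qed.

Lemma strongly_convex_fine (mu : R) z u g : strongly_convex mu h ->
  subgradient h z g -> dom z -> dom u ->
  hr z + dot g (u - z) + mu / 2 * dot (u - z) (u - z) <= hr u.
Proof.
move=> hmu /(hmu z u g) H dz du; move: H.
by rewrite (proper_fineK dz) (proper_fineK du) -EFinD lee_fin enorm_sqr addrA.
Qed.

End ProperConvex.

(** * Existence and three-point inequality for proximal steps *)

Section Prox.
Context {R : realType} {N : nat}.
Variable h : 'rV[R]_N -> \bar R.
Hypotheses (hproper : proper_fun h) (hconvex : convex_efun h) (hclosed : closed_fun h).
Variables (xs p : 'rV[R]_N).
Hypotheses (dxs : (h xs < +oo)%E) (pxs : subgradient h xs p).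
Implicit Types (u v w z g : 'rV[R]_N).

Let prox_obj g w (k : R) u := ((dot g u + k * enorm (u - w) ^+ 2)%:E + h u)%E.

(** Since h may be infinite and discontinuous, the continuous function Q is minimized over pairs (u,
    s) of the epigraph instead. The affine minorant with slope p confines a sublevel set of Q to a
    box, and closedness of the epigraph makes its trace on the box compact. *)
Lemma prox_exists g w (k : R) : 0 < k -> exists z, is_minimizer (prox_obj g w k) z.
Proof.
move=> k0.
pose Q (c : 'rV[R]_N * R) := dot c.1 g + k * dot (c.1 - w) (c.1 - w) + c.2.
have Qobj u s : h u = s%:E -> prox_obj g w k u = (Q (u, s))%:E.
  by move=> hu; rewrite /prox_obj hu -EFinD /Q /= dotC enorm_sqr.
pose s0 := fine (h xs).
have hxs : h xs = s0%:E by rewrite /s0 -proper_fineK.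
pose q0 := Q (xs, s0).
have minor u s : (h u <= s%:E)%E -> s0 + dot p (u - xs) <= s.
  by move=> us; rewrite -lee_fin; apply: le_trans us; rewrite EFinD -hxs.
(* With e = u - w, the minorant and Q <= q0 bound k |e|^2 by a constant minus the product of g + p
   with e. Young with parameter k keeps half of k |e|^2, whence |e|^2 <= rho. Young with parameter 1
   then gives the range [lo, hi] of s. *)
pose rho := 2 / k * (q0 - dot w g - s0 - dot p (w - xs) + dot (g + p) (g + p) / (2 * k)).
pose r := Num.sqrt rho.
pose lo := s0 + dot p (w - xs) - dot p p / 2 - rho / 2.
pose hi := q0 - dot w g + dot g g / 2 + rho / 2.
pose box := [set u : 'rV[R]_N | forall i, [set t | t \in `[w 0 i - r, w 0 i + r]] (u 0 i)].
pose K := (box `*` [set t | t \in `[lo, hi]]) `&` [set c | (h c.1 <= c.2%:E)%E].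
have sublevel u s : (h u <= s%:E)%E -> Q (u, s) <= q0 -> K (u, s).
  move=> us Qu; have m := minor u s us.
  have [e eE] : exists e, u - w = e by exists (u - w).
  have uE : u = w + e by rewrite -eE addrC subrK.
  have De : dot e e <= rho.
    rewrite /rho -[2 / k]invf_div ler_pdivlMl ?divr_gt0 //.
    have := @dot_young _ _ k (g + p) (- e) k0.
    move: Qu m; rewrite /Q /= eE uE; set n := dot (g + p) (g + p) / _.
    rewrite !dotE !opprK !(dotC g e); lra.
  have rho0 : 0 <= rho by apply: le_trans De; exact: dot_ge0.
  split; last by [].
  split => /=.
    move=> i; change (u 0 i \in `[w 0 i - r, w 0 i + r]); rewrite in_itv /=.
    have : `|e 0 i| <= r.
      rewrite -(@ler_pXn2r _ 2) ?nnegrE ?sqrtr_ge0 // real_normK ?num_real //.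
      rewrite sqr_sqrtr //; apply: le_trans De; rewrite /dot (bigD1 i) //= -expr2.
      by rewrite lerDl sumr_ge0 // => j _; rewrite -expr2 sqr_ge0.
    by rewrite ler_norml uE mxE => /andP[? ?]; apply/andP; split; lra.
  have y1 := @dot_young _ _ 1 p (- e) ltr01.
  have y2 := @dot_young _ _ 1 g (- e) ltr01.
  rewrite mulr1 in y1 y2.
  have ke := mulr_ge0 (ltW k0) (dot_ge0 e).
  change (s \in `[lo, hi]); rewrite in_itv /= /lo /hi; apply/andP; split; move: Qu m; rewrite /Q /= eE uE;
    move: y1 y2 ke De; rewrite !dotE (dotC g e); lra.
have Kxs : K (xs, s0) by apply: sublevel => //=; rewrite hxs.
have Kcompact : compact K.
  apply: compact_closedI; last exact: hclosed.
  apply: compact_setX; last exact: segment_compact.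
  exact: (@rV_compact R N (fun i => `[w 0 i - r, w 0 i + r]%classic) (fun i => @segment_compact R _ _)).
have Qcont : {within K, continuous Q}.
  apply: continuous_subspaceT => c; rewrite /Q.
  have c1 : (fun c : 'rV[R]_N * R => c.1) @ c --> c.1 by exact: cvg_fst.
  apply: cvgD; last exact: cvg_snd.
  apply: cvgD.
    apply: (cvg_comp (fun c : 'rV[R]_N * R => c.1) (fun v => dot v g) c1).
    exact: dot_continuous.
  apply: cvgMl_tmp.
  apply: (cvg_comp (fun c : 'rV[R]_N * R => c.1 - w) (fun v => dot v v)).
    by apply: cvgB c1 _; exact: cvg_cst.
  exact: dot_self_continuous.
have [[z s] /set_mem Kz Qmin] := compact_EVT_min (ex_intro _ _ Kxs) Kcompact Qcont.
have zs : (h z <= s%:E)%E by case: Kz.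
have hz := proper_fineK hproper (ltey_of_leEFin zs).
have zle : (prox_obj g w k z <= (Q (z, s))%:E)%E.
  rewrite (Qobj _ _ hz) lee_fin lerD2l /= -lee_fin -hz //.
exists z => u; apply: le_trans zle _.
have [du|] := boolP (h u < +oo)%E; last first.
  by rewrite ltey negbK => /eqP hu; rewrite /prox_obj hu addey // leey.
have hu := proper_fineK hproper du; rewrite (Qobj _ _ hu) lee_fin.
(* Outside the sublevel set, Q is at least q0, a value attained in K at (xs, s0). *)
have [Qu|/ltW Qu] := leP (Q (u, fine (h u))) q0.
  by apply: Qmin; apply: mem_set; apply: sublevel => //; rewrite -hu.
by apply: le_trans Qu; apply: Qmin; exact: mem_set.
Qed.

(** The quadratic part is its own upper model, so minus its gradient at z is a subgradient of h
    there. The gain k + mu/2 adds the curvature of the quadratic and the strong convexity of h. *)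
Lemma prox_ineq (mu : R) g w (k : R) : 0 < k -> strongly_convex mu h ->
  let z := argmin (prox_obj g w k) in
  (h z < +oo)%E /\ forall u, (h u < +oo)%E ->
  fine (h z) + dot g z + k * dot (z - w) (z - w) + (k + mu / 2) * dot (u - z) (u - z) <=
  fine (h u) + dot g u + k * dot (u - w) (u - w).
Proof.
move=> k0 hmu z.
have zmin : is_minimizer (prox_obj g w k) z.
  have [z0 z0min] := prox_exists g w k0.
  exact: (@getPex _ (is_minimizer (prox_obj g w k)) (ex_intro _ z0 z0min)).
have dz : (h z < +oo)%E.
  have := zmin xs; rewrite /prox_obj (proper_fineK hproper dxs) -EFinD.
  by case: (h z) => [r _||_]; rewrite ?ltry ?ltNyr // addey // leye_eq.
pose q u := dot g u + k * dot (u - w) (u - w).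
have zle u : (h u < +oo)%E -> fine (h z) + q z <= fine (h u) + q u.
  move=> du; have := zmin u.
  rewrite /prox_obj (proper_fineK hproper dz) (proper_fineK hproper du).
  by rewrite -!EFinD lee_fin !enorm_sqr /q !(addrC (fine _)).
have qup d : q (z + d) <= q z + dot (g + (2 * k) *: (z - w)) d + k * dot d d.
  rewrite /q le_eqVlt; apply/orP; left; apply/eqP.
  rewrite !dotE (dotC d z) (dotC d w) (dotC w z); ring.
have sg := subgradient_of_min hproper hconvex dz zle qup.
split=> // u du.
have := strongly_convex_fine hproper hmu sg dz du.
rewrite !dotE (dotC u z) (dotC u w) (dotC z w); lra.
Qed.

End Prox.

(** * Uniform means over finite types and the variance of sample means *)

Section Average.
Context {R : realType}.
Implicit Types (T U : finType).

(** Real counterpart of [unif_expectation], to which the latter reduces once all values are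
    finite. *)
Definition avg T (X : T -> R) : R := #|T|%:R^-1 * \sum_w X w.

Definition avgv N T (X : T -> 'rV[R]_N) : 'rV[R]_N := #|T|%:R^-1 *: \sum_w X w.

Lemma ler_avg T (X Y : T -> R) : (forall w, X w <= Y w) -> avg X <= avg Y.
Proof.
by move=> XY; rewrite ler_wpM2l ?invr_ge0 ?ler0n //; apply: ler_sum => w _.
Qed.

Lemma avgD T (X Y : T -> R) : avg (fun w => X w + Y w) = avg X + avg Y.
Proof. by rewrite /avg big_split mulrDr. Qed.

Lemma avgZ T (a : R) (X : T -> R) : avg (fun w => a * X w) = a * avg X.
Proof. by rewrite /avg -mulr_sumr mulrCA. Qed.

Lemma avg_cst T (a : R) : (0 < #|T|)%N -> avg (fun _ : T => a) = a.
Proof.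
move=> T0; rewrite /avg sumr_const -[a *+ _]mulr_natl mulKf //.
by rewrite pnatr_eq0 -lt0n.
Qed.

Lemma avg_le_cst T (X : T -> R) (a : R) :
  (0 < #|T|)%N -> (forall w, X w <= a) -> avg X <= a.
Proof. by move=> T0 Xa; rewrite -[leRHS](avg_cst a T0); exact: ler_avg. Qed.

Lemma avg_pair T U (X : T * U -> R) : avg X = avg (fun t => avg (fun u => X (t, u))).
Proof.
rewrite /avg card_prod natrM invfM -mulr_sumr mulrA; congr (_ * _).
by rewrite (pair_bigA _ (fun t u => X (t, u))); apply: eq_bigr => -[].
Qed.

Lemma avg_draw n1 n2 A B C (X : draw n1 n2 A B C -> R) :
  avg X = avg (fun a : A.-tuple 'I_n2 => avg (fun b : B.-tuple 'I_n2 =>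
    avg (fun c : C.-tuple 'I_n1 => X (a, b, c)))).
Proof.
rewrite -(avg_pair (fun ab : A.-tuple 'I_n2 * B.-tuple 'I_n2 =>
  avg (fun c : C.-tuple 'I_n1 => X (ab.1, ab.2, c)))).
rewrite -(avg_pair (fun d : A.-tuple 'I_n2 * B.-tuple 'I_n2 * C.-tuple 'I_n1 =>
  X (d.1.1, d.1.2, d.2))).
by rewrite /avg; congr (_ * _); apply: eq_bigr => -[[a b] c].
Qed.

Lemma avg_exchange T U (X : T -> U -> R) :
  avg (fun t => avg (X t)) = avg (fun u => avg (X^~ u)).
Proof. by rewrite /avg -!mulr_sumr exchange_big /= mulrCA. Qed.

(** Plays the role of conditioning on the first draw: the uniform law on tuples is a product law. *)
Lemma avg_tupleS T n (X : n.+1.-tuple T -> R) :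
  avg X = avg (fun t => avg (fun w : n.-tuple T => X [tuple of t :: w])).
Proof.
rewrite -(avg_pair (fun tw : T * n.-tuple T => X [tuple of tw.1 :: tw.2])) /avg.
rewrite card_prod !card_tuple expnS; congr (_ * _).
rewrite (reindex (fun tw : T * n.-tuple T => [tuple of tw.1 :: tw.2])) //=.
exists (fun w => (thead w, [tuple of behead w])) => [[t w] _|w _] /=.
  by rewrite theadE; congr pair; apply: val_inj.
by rewrite [RHS]tuple_eta.
Qed.

Lemma avg_tuple0 T (X : 0.-tuple T -> R) : avg X = X [tuple].
Proof.
rewrite /avg card_tuple expn0 invr1 mul1r (big_pred1 [tuple]) // => w.
by rewrite [w]tuple0; apply/esym/eqP.
Qed.

Lemma card_tuple_gt0 T n : (0 < #|T|)%N -> (0 < #|{:n.-tuple T}|)%N.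
Proof. by move=> T0; rewrite card_tuple expn_gt0 T0. Qed.

Lemma dot_avgv N T (X : T -> 'rV[R]_N) v : dot (avgv X) v = avg (fun t => dot (X t) v).
Proof. by rewrite /avgv dotZl dot_suml. Qed.

(** Additivity of the variance: the cross terms vanish because the draws are independent and Y has
    mean 0. *)
Lemma avg_dot_sum_centered N T n (Y : T -> 'rV[R]_N) :
  (0 < #|T|)%N -> avgv Y = 0 ->
  avg (fun w : n.-tuple T => dot (\sum_(i <- w) Y i) (\sum_(i <- w) Y i)) =
  n%:R * avg (fun t => dot (Y t) (Y t)).
Proof.
move=> T0 Y0; elim: n => [|n IH]; first by rewrite avg_tuple0 big_nil dot0l mul0r.
rewrite avg_tupleS.
have E t : avg (fun w : n.-tuple T =>
      dot (\sum_(i <- t :: w) Y i) (\sum_(i <- t :: w) Y i)) =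
    dot (Y t) (Y t) + (n%:R * avg (fun t => dot (Y t) (Y t)) +
      avg (fun w : n.-tuple T => 2 * dot (Y t) (\sum_(i <- w) Y i))).
  rewrite -IH -(avg_cst (dot (Y t) (Y t)) (card_tuple_gt0 n T0)) -!avgD.
  rewrite /avg; congr (_ * _); apply: eq_bigr => w _; rewrite big_cons.
  by rewrite !dotE (dotC _ (Y t)); ring.
under [X in avg X]eq_fun => t do rewrite E.
rewrite avgD avgD avg_cst // avg_exchange -[n.+1]add1n natrD mulrDl mul1r.
congr (_ + _); rewrite -[RHS]addr0; congr (_ + _).
under [X in avg X]eq_fun => w do rewrite avgZ -dot_avgv Y0 dot0l mulr0.
by rewrite avg_cst ?card_tuple_gt0.
Qed.

Lemma avg_sample_mean_le N T n (X : T -> 'rV[R]_N) (b : R) :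
  (0 < #|T|)%N -> (0 < n)%N -> (forall t, dot (X t) (X t) <= b) ->
  avg (fun w : n.-tuple T => dot (n%:R^-1 *: (\sum_(i <- w) X i) - avgv X)
                                 (n%:R^-1 *: (\sum_(i <- w) X i) - avgv X)) <= b / n%:R.
Proof.
move=> T0 n0 Xb; pose Y t := X t - avgv X.
have n0' : n%:R != 0 :> R by rewrite pnatr_eq0 -lt0n.
have T0' : #|T|%:R != 0 :> R by rewrite pnatr_eq0 -lt0n.
have Y0 : avgv Y = 0.
  rewrite /avgv /Y sumrB scalerBr -/(avgv X) sumr_const.
  by rewrite -[X in _ - _ *: X]scaler_nat scalerA mulVf // scale1r subrr.
have E (w : n.-tuple T) : n%:R^-1 *: (\sum_(i <- w) X i) - avgv X =
    n%:R^-1 *: (\sum_(i <- w) Y i).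
  rewrite /Y sumrB scalerBr; congr (_ - _).
  rewrite big_const_seq count_predT size_tuple iter_addr_0.
  by rewrite -[X in _ *: X]scaler_nat scalerA mulVf // scale1r.
under [X in avg X]eq_fun => w do rewrite E dotZl dotZr mulrA.
rewrite avgZ avg_dot_sum_centered // mulrA -(mulrA _ _ n%:R) mulVf // mulr1 mulrC.
rewrite ler_wpM2r ?invr_ge0 ?ler0n //.
(* Centring lowers the second moment by exactly |avgv X|^2. *)
apply: (le_trans (y := avg (fun t => dot (X t) (X t)))); last exact: avg_le_cst.
have -> : avg (fun t => dot (Y t) (Y t)) =
    avg (fun t => dot (X t) (X t)) + (- dot (avgv X) (avgv X)).
  have H t : dot (Y t) (Y t) =
      dot (X t) (X t) + (dot (avgv X) (avgv X) + - 2 * dot (X t) (avgv X)).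
    by rewrite /Y; move: (avgv X) => a; rewrite !dotE (dotC a (X t)); ring.
  under [X in avg X = _]eq_fun => t do rewrite H.
  by rewrite !avgD avg_cst // avgZ -dot_avgv; ring.
by rewrite gerDl oppr_le0 dot_ge0.
Qed.

End Average.

(** * The composite gradient and the mean square error of its estimator *)

Section Composition.
Context {R : realType} {N1 N2 n1 n2 : nat}.
Variables (F : 'I_n1 -> 'rV[R]_N1 -> R) (G : 'I_n2 -> 'rV[R]_N2 -> 'rV[R]_N1).
Hypotheses (dF : forall i x, differentiable (F i) x)
           (dG : forall j x, differentiable (G j) x).
Implicit Types (x : 'rV[R]_N2).

Lemma avgv_ord N n (X : 'I_n -> 'rV[R]_N) : avgv X = n%:R^-1 *: \sum_i X i.
Proof. by rewrite /avgv card_ord. Qed.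

Lemma enorm_avgv_le N (T : finType) (X : T -> 'rV[R]_N) (b : R) : 0 <= b ->
  (forall t, enorm (X t) <= b) -> enorm (avgv X) <= b.
Proof.
by move=> b0 Xb; rewrite /avgv cardE -big_enum; exact: enorm_mean_le.
Qed.

Lemma avgvB N (T : finType) (X Y : T -> 'rV[R]_N) :
  avgv (fun t => X t - Y t) = avgv X - avgv Y.
Proof. by rewrite /avgv sumrB scalerBr. Qed.

(** The exact J' is a control variate: multiplied by g, the error becomes a centred sample mean of
    the differences, to which the variance bound applies. *)
Lemma mulmx_sample_error p q (T : finType) n (w : seq T) (g : 'rV[R]_p)
    (Y Y' : T -> 'M[R]_(p, q)) (J J' : 'M[R]_(p, q)) :
  g *m J = avgv (fun t => g *m Y t) -> g *m J' = avgv (fun t => g *m Y' t) ->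
  g *m ((n%:R^-1 *: \sum_(t <- w) (Y t - Y' t) + J') - J) =
  n%:R^-1 *: (\sum_(t <- w) g *m (Y t - Y' t)) - avgv (fun t => g *m (Y t - Y' t)).
Proof.
move=> gJ gJ'.
have -> : avgv (fun t => g *m (Y t - Y' t)) = g *m J - g *m J'.
  by rewrite gJ gJ' -avgvB; congr avgv; apply/funext => t; rewrite mulmxBr.
rewrite mulmxBr mulmxDr -scalemxAr mulmx_sumr opprB -!addrA.
by congr (_ + _).
Qed.

(* The error is split into the errors caused by the sample [b] (through [Jh]),
   by the sample [a] (through [p]) and by the sample [w] itself. *)
Lemma grad_est_error p q (T : Type) n (w : seq T) (P Q Z : T -> 'rV[R]_p)
    (Jh J J' : 'M[R]_(p, q)) (f f' : 'rV[R]_q) :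
  n%:R^-1 *: \sum_(t <- w) (P t *m Jh - Q t *m J') + f' - f =
  (n%:R^-1 *: \sum_(t <- w) P t) *m (Jh - J)
  + (n%:R^-1 *: \sum_(t <- w) (P t - Z t)) *m J
  + (n%:R^-1 *: \sum_(t <- w) (Z t *m J - Q t *m J') - (f - f')).
Proof.
have -> : \sum_(t <- w) (P t *m Jh - Q t *m J') = (\sum_(t <- w) P t) *m (Jh - J)
    + (\sum_(t <- w) (P t - Z t)) *m J + \sum_(t <- w) (Z t *m J - Q t *m J').
  rewrite !mulmx_suml -!big_split; apply: eq_bigr => t _ /=.
  by rewrite mulmxBr mulmxBl !addrA subrK subrK.
by rewrite !scalerDr !scalemxAl opprB -!addrA.
Qed.

Lemma is_diff_mean (V W : normedModType R) n (f : 'I_n -> V -> W) (k : R) (p : V) :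
  (forall i, differentiable (f i) p) ->
  is_diff p (fun q => k *: \sum_i f i q) (fun d => k *: \sum_i ('d (f i) p d : W)).
Proof.
move=> df.
have sumE (g : 'I_n -> V -> W) : (fun q => k *: \sum_i g i q) = k *: (\sum_i g i).
  by apply/funext => q; rewrite /= fct_sumE.
rewrite (sumE f) (sumE (fun i => ('d (f i) p : V -> W))).
apply: is_diffZ; elim/big_ind2 : _ => [|? ? ? ? ? ?|i _].
- exact: is_diff_cst.
- exact: is_diffD.
- exact: differentiableP.
Qed.

Lemma is_diff_Gavg x :
  is_diff x (Gavg G) (fun v => n2%:R^-1 *: \sum_j ('d (G j) x v : 'rV[R]_N1)).
Proof. by apply: (@is_diff_mean 'rV[R]_N2 'rV[R]_N1). Qed.

Lemma is_diff_Favg y :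
  is_diff y (Favg F) (fun v => n1%:R^-1 *: \sum_i ('d (F i) y v : R)).
Proof. by apply: (@is_diff_mean 'rV[R]_N1 R). Qed.

Lemma differentiable_fcomp x : differentiable (fcomp F G) x.
Proof.
apply: differentiable_comp; first by case: (is_diff_Gavg x).
by case: (is_diff_Favg (Gavg G x)).
Qed.

Lemma mulmx_Jac_Gavg x (g : 'rV[R]_N1) :
  g *m Jac (Gavg G) x = avgv (fun j => g *m Jac (G j) x).
Proof.
have [dGx dGE] := is_diff_Gavg x.
apply/eqP; rewrite -subr_eq0; apply/eqP/dot_eq0; move: (X in dot _ X) => v.
rewrite dotDl dotNl dot_mulmx -diff_Jac // dGE avgv_ord dotZl dotZr.
rewrite dot_sumr dot_suml -mulrBr -sumrB big1 ?mulr0 // => j _.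
by rewrite dot_mulmx -diff_Jac // subrr.
Qed.

(** The contribution of one outer component, with exact inner values; these terms average to the
    gradient of [fcomp F G]. *)
Definition grad_term i x := gradient (F i) (Gavg G x) *m Jac (Gavg G) x.

Lemma gradient_fcomp x : gradient (fcomp F G) x = avgv (fun i => grad_term i x).
Proof.
have [dGx _] := is_diff_Gavg x; have [dFx dFE] := is_diff_Favg (Gavg G x).
apply: gradient_eq => [|v]; first exact: differentiable_fcomp.
have -> : fcomp F G = Favg F \o Gavg G by [].
rewrite diff_comp //= dFE avgv_ord dotZl dot_suml; congr (_ * _).
apply: eq_bigr => i _.
by rewrite diff_gradient // diff_Jac // -dot_mulmx.
Qed.

Variable L : R.
Hypothesis hL : forall i j x y,
  enorm (gradient (F i) (Gavg G x) *m Jac (G j) x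
         - gradient (F i) (Gavg G y) *m Jac (G j) y) <= L * enorm (x - y).
Hypotheses (n1_gt0 : (0 < n1)%N) (n2_gt0 : (0 < n2)%N).

Lemma lipschitz_rhs_ge0 x y : 0 <= L * enorm (x - y).
Proof.
exact: le_trans (enorm_ge0 _) (hL (Ordinal n1_gt0) (Ordinal n2_gt0) x y).
Qed.

Lemma grad_term_lipschitz i x y :
  enorm (grad_term i x - grad_term i y) <= L * enorm (x - y).
Proof.
rewrite /grad_term !mulmx_Jac_Gavg -avgvB.
by apply: enorm_avgv_le => [|j]; [exact: lipschitz_rhs_ge0 | exact: hL].
Qed.

Lemma gradient_fcomp_lipschitz x y :
  enorm (gradient (fcomp F G) x - gradient (fcomp F G) y) <= L * enorm (x - y).
Proof.
rewrite !gradient_fcomp -avgvB.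
by apply: enorm_avgv_le => [|j]; [exact: lipschitz_rhs_ge0 | exact: grad_term_lipschitz].
Qed.

Variables (LF BF LG BG : R).
Hypotheses (hLF : forall i, smooth_fun LF (F i)) (hBF : forall i, bounded_gradient BF (F i)).
Hypotheses (hLG : forall j, smooth_map LG (G j)) (hBG : forall j, bounded_Jac BG (G j)).

Let BF_ge0 : 0 <= BF.
Proof. exact: le_trans (enorm_ge0 _) (hBF (Ordinal n1_gt0) 0). Qed.

Let BG_ge0 : 0 <= BG.
Proof. exact: le_trans (specnorm_ge0 _) (hBG (Ordinal n2_gt0) 0). Qed.

Variables (A B C : nat).
Hypotheses (A_gt0 : (0 < A)%N) (B_gt0 : (0 < B)%N) (C_gt0 : (0 < C)%N).
Variables (xt x : 'rV[R]_N2).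
Let D := dot (x - xt) (x - xt).

Let card_ord_gt0 n : (0 < n)%N -> (0 < #|'I_n|)%N.
Proof. by rewrite card_ord. Qed.

Lemma avg_Ghat_error_le :
  avg (fun a : A.-tuple 'I_n2 => dot (Ghat G a xt x - Gavg G x) (Ghat G a xt x - Gavg G x))
  <= BG ^+ 2 * D / A%:R.
Proof.
have E (a : A.-tuple 'I_n2) : Ghat G a xt x - Gavg G x =
    A%:R^-1 *: (\sum_(i <- a) (G i x - G i xt)) - avgv (fun i => G i x - G i xt).
  by rewrite avgvB !avgv_ord /Ghat -addrA opprB addrC.
under [X in avg X]eq_fun => a do rewrite E.
apply: avg_sample_mean_le => // [|j]; first exact: card_ord_gt0.
have := bounded_Jac_lipschitz x xt (dG j) (hBG j) => /dot_le_sqr.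
by rewrite exprMn enorm_sqr.
Qed.

Lemma avg_Jhat_error_le (g : 'rV[R]_N1) : enorm g <= BF ->
  avg (fun b : B.-tuple 'I_n2 => dot (g *m (Jhat G b xt x - Jac (Gavg G) x))
                                     (g *m (Jhat G b xt x - Jac (Gavg G) x)))
  <= BF ^+ 2 * LG ^+ 2 * D / B%:R.
Proof.
move=> gBF; pose X j := g *m (Jac (G j) x - Jac (G j) xt).
have E (b : B.-tuple 'I_n2) : g *m (Jhat G b xt x - Jac (Gavg G) x) =
    B%:R^-1 *: (\sum_(j <- b) X j) - avgv X.
  exact: mulmx_sample_error (mulmx_Jac_Gavg x g) (mulmx_Jac_Gavg xt g).
under [X in avg X]eq_fun => b do rewrite E.
apply: avg_sample_mean_le => // [|j]; first exact: card_ord_gt0.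
have H : enorm (X j) <= BF * (LG * enorm (x - xt)).
  apply: le_trans (enorm_mulmx_le _ _) _; rewrite mulrC.
  by apply: ler_pM => //; [exact: enorm_ge0 | exact: specnorm_ge0 | exact: hLG].
by have := dot_le_sqr H; rewrite !exprMn enorm_sqr mulrA.
Qed.

Lemma avg_grad_term_error_le :
  avg (fun c : C.-tuple 'I_n1 =>
    dot (C%:R^-1 *: (\sum_(i <- c) (grad_term i x - grad_term i xt))
         - (gradient (fcomp F G) x - gradient (fcomp F G) xt))
        (C%:R^-1 *: (\sum_(i <- c) (grad_term i x - grad_term i xt))
         - (gradient (fcomp F G) x - gradient (fcomp F G) xt)))
  <= L ^+ 2 * D / C%:R.
Proof.
rewrite !gradient_fcomp -avgvB.
apply: avg_sample_mean_le => // [|i]; first exact: card_ord_gt0.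
by have := dot_le_sqr (grad_term_lipschitz i x xt); rewrite exprMn enorm_sqr.
Qed.

(* Averages over the draws are evaluated one sample at a time, so that the
   Jacobian error is only ever seen through a fixed vector: this is what makes
   a variance bound available for the spectral norm. *)
Lemma avg_grad_est_error_le :
  avg (fun d : draw n1 n2 A B C =>
    dot (grad_est F G d xt x - gradient (fcomp F G) x)
        (grad_est F G d xt x - gradient (fcomp F G) x))
  <= (4 * (BF ^+ 2 * LG ^+ 2 / B%:R) + 4 * (BG ^+ 4 * LF ^+ 2 / A%:R)
      + 2 * (L ^+ 2 / C%:R)) * D.
Proof.
(* [gm] depends on a and c but not on b, so it is a fixed vector of norm at most BF while b is
   averaged. *)
pose gm (a : A.-tuple 'I_n2) (c : C.-tuple 'I_n1) :=
  C%:R^-1 *: \sum_(i <- c) gradient (F i) (Ghat G a xt x).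
pose tB a (b : B.-tuple 'I_n2) c := gm a c *m (Jhat G b xt x - Jac (Gavg G) x).
pose tA (a : A.-tuple 'I_n2) (c : C.-tuple 'I_n1) := (C%:R^-1 *: \sum_(i <- c)
  (gradient (F i) (Ghat G a xt x) - gradient (F i) (Gavg G x))) *m Jac (Gavg G) x.
pose tC (c : C.-tuple 'I_n1) :=
  C%:R^-1 *: (\sum_(i <- c) (grad_term i x - grad_term i xt))
  - (gradient (fcomp F G) x - gradient (fcomp F G) xt).
have E a b c : grad_est F G (a, b, c) xt x - gradient (fcomp F G) x =
    tB a b c + tA a c + tC c.
  exact: grad_est_error.
have gmBF a c : enorm (gm a c) <= BF.
  rewrite /gm -{1}(size_tuple c); apply: enorm_mean_le => // i; exact: hBF.
have tA_le a c : dot (tA a c) (tA a c) <=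
    BG ^+ 2 * LF ^+ 2 * dot (Ghat G a xt x - Gavg G x) (Ghat G a xt x - Gavg G x).
  set u := Ghat G a xt x - Gavg G x.
  have b0 : 0 <= LF * enorm u.
    exact: le_trans (enorm_ge0 _) (hLF (Ordinal n1_gt0) _ _).
  rewrite -enorm_sqr -(enorm_sqr u) -!exprMn -mulrA.
  rewrite ler_pXn2r ?nnegrE ?enorm_ge0 ?(mulr_ge0 BG_ge0 b0) //.
  rewrite /tA mulmx_Jac_Gavg; apply: enorm_avgv_le => [|j]; first exact: mulr_ge0.
  apply: le_trans (enorm_mulmx_le _ _) _.
  apply: ler_pM; [exact: specnorm_ge0 | exact: enorm_ge0 | exact: hBG |].
  by rewrite -{1}(size_tuple c); apply: enorm_mean_le => // i; exact: hLF.
have nA := card_tuple_gt0 A (card_ord_gt0 n2_gt0).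
have nB := card_tuple_gt0 B (card_ord_gt0 n2_gt0).
have nC := card_tuple_gt0 C (card_ord_gt0 n1_gt0).
rewrite avg_draw.
(* The factors 4, 4, 2 come from applying |u + v|^2 <= 2 |u|^2 + 2 |v|^2 twice. *)
apply: (le_trans (y := avg (fun a : A.-tuple 'I_n2 => avg (fun b : B.-tuple 'I_n2 =>
   avg (fun c : C.-tuple 'I_n1 =>
    4 * dot (tB a b c) (tB a b c) + (4 * (BG ^+ 2 * LF ^+ 2) *
      dot (Ghat G a xt x - Gavg G x) (Ghat G a xt x - Gavg G x)
    + 2 * dot (tC c) (tC c))))))).
  apply: ler_avg => a; apply: ler_avg => b; apply: ler_avg => c; rewrite E.
  have := dot_sqrD_le2 (tB a b c + tA a c) (tC c).
  have := dot_sqrD_le2 (tB a b c) (tA a c).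
  by have := tA_le a c; lra.
under [X in avg X]eq_fun => a.
  under [X in avg X]eq_fun => b do rewrite avgD avgD avg_cst // !avgZ.
  rewrite avgD avg_cst // avgZ avg_exchange.
  over.
rewrite avgD avgD avg_cst // (avgZ 4) (avgZ (4 * (BG ^+ 2 * LF ^+ 2))).
have HB : avg (fun a => avg (fun c => avg (fun b => dot (tB a b c) (tB a b c)))) <=
    BF ^+ 2 * LG ^+ 2 * D / B%:R.
  apply: avg_le_cst => // a; apply: avg_le_cst => // c.
  exact: avg_Jhat_error_le.
have HA := avg_Ghat_error_le.
have HC := avg_grad_term_error_le.
have HA' := ler_wpM2l (mulr_ge0 (sqr_ge0 BG) (sqr_ge0 LF)) HA.
have -> : BG ^+ 4 = BG ^+ 2 * BG ^+ 2 by rewrite -exprD.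
by move: HB HA' HC; rewrite /tC; lra.
Qed.

End Composition.

(** * Scalar inequalities behind one coupled step *)

Lemma cancel_common_term (R : realType) (u v a b c k q r : R) :
  u + (a + c) + k + q <= v + (b + c) + r -> 0 <= q -> u + a + k <= v + b + r.
Proof. lra. Qed.

Lemma subtract_common_term (R : realType) (u v a b c k q r : R) :
  u + a + k + q <= v + b + r -> u + (a - c) + k + q <= v + (b - c) + r.
Proof. lra. Qed.

(** Here [qyx] and [eyx] stand for the products of the exact gradient and of the error with y - x,
    [exz] for that of the error with xs - z0, and [nyx], [nzz], [nz], [n0] for |y - x|^2, |z -
    z0|^2, |z - xs|^2, |z0 - xs|^2. The terms in [nyx] cancel because L/2 + L = 3L/2; those in [nzz]
    cancel because alpha makes both proximal coefficients equal to 3/2 tau^2 L. *)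
Lemma coupled_step_arith (R : realType) (tau L mu fx fy fs fxt fy0 hy hz hs hxt hy0 hv
    gzz qyx qxz eyx exz nyx nzz nz n0 ee : R) :
  fy <= fx + qyx + L / 2 * nyx ->
  - eyx <= ee / (4 * L) + 2 * L / 2 * nyx ->
  fx + tau * qxz <= tau * fs + tau * fxt + (1 - 2 * tau) * fy0 ->
  hy + (qyx + eyx) + 3 * L / 2 * nyx <= hv + tau * gzz + 3 * L / 2 * (tau ^+ 2 * nzz) ->
  tau * (hz + gzz + 3 / 2 * tau * L * nzz + (3 / 2 * tau * L + mu / 2) * nz) <=
    tau * (hs + (qxz + exz) + 3 / 2 * tau * L * n0) ->
  hv <= tau * hz + tau * hxt + (1 - 2 * tau) * hy0 ->
  fy + hy - (fs + hs) + tau * (3 / 2 * tau * L + mu / 2) * nz <=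
  tau * (fxt + hxt - (fs + hs)) + (1 - 2 * tau) * (fy0 + hy0 - (fs + hs))
  + tau * (3 / 2 * tau * L) * n0 + ee / (4 * L) + tau * exz.
Proof. lra. Qed.

(** * Convex smooth plus strongly convex objectives and the coupled proximal step *)

Section ConvexSmooth.
Context {R : realType} {N : nat}.
Variables (f : 'rV[R]_N -> R) (L : R).
Hypotheses (df : forall x, differentiable f x)
  (fL : forall x y, enorm (gradient f x - gradient f y) <= L * enorm (x - y)).

Lemma smooth_lower (x d : 'rV[R]_N) :
  f x + dot (gradient f x) d - L / 2 * dot d d <= f (x + d).
Proof.
have dNf y : differentiable (- f) y by exact: differentiableN.
have gN y : gradient (- f) y = - gradient f y.
  apply: gradient_eq => // v; rewrite diffN // dotNl -diff_gradient //.
have NfL y z : enorm (gradient (- f) y - gradient (- f) z) <= L * enorm (y - z).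
  by rewrite !gN -opprD enormN fL.
have := smooth_upper x d dNf NfL.
by rewrite gN dotNl opprfctE; lra.
Qed.

Hypothesis fconvex : convex_function setT f.

Lemma convex_functionP (t : R) x y : 0 <= t -> t <= 1 ->
  f (t *: x + (1 - t) *: y) <= t * f x + (1 - t) * f y.
Proof.
move=> t0 t1; have t01 : 0 <= t <= 1 by rewrite t0 t1.
exact: (fconvex (Itv01 t0 t1) (in_setT x) (in_setT y)).
Qed.

(** Convexity on the segment is compared with the lower quadratic model, whose error is of second
    order in t. *)
Lemma convex_gradient_le x y : f x + dot (gradient f x) (y - x) <= f y.
Proof.
rewrite -subr_ge0; set d := y - x.
apply: (@linear_perturbation_ge0 _ _ (L / 2 * dot d d)) => t t0 t1.
have := convex_functionP y x (ltW t0) t1.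
have -> : t *: y + (1 - t) *: x = x + t *: d.
  by rewrite scalerBl scale1r /d scalerBr addrCA.
have := smooth_lower x (t *: d); rewrite dotZr dotZl dotZr => H1 H2.
rewrite -(@pmulr_rge0 _ t) //; move: H1 H2; lra.
Qed.

Variables (h : 'rV[R]_N -> \bar R) (mu : R) (xs : 'rV[R]_N).
Hypotheses (hproper : proper_fun h) (hconvex : convex_efun h)
  (hclosed : closed_fun h) (hmu : strongly_convex mu h) (mu_gt0 : 0 < mu).
Hypotheses (dxs : (h xs < +oo)%E)
  (xsmin : is_minimizer (fun x => ((f x)%:E + h x)%E) xs).

(** This is a(x) of the outline; it is meaningful where h is finite, since [fine] sends infinities
    to 0. *)
Definition gap x := f x + fine (h x) - (f xs + fine (h xs)).

Lemma fine_minimizer u : (h u < +oo)%E ->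
  fine (h xs) + f xs <= fine (h u) + f u.
Proof.
move=> du; have := xsmin u.
rewrite (proper_fineK hproper dxs) (proper_fineK hproper du).
by rewrite -!EFinD lee_fin !(addrC (fine _)).
Qed.

Lemma gap_ge0 u : (h u < +oo)%E -> 0 <= gap u.
Proof. by move=> /fine_minimizer; rewrite /gap; lra. Qed.

(** Fermat's rule at the minimizer; it supplies the affine minorant that the proximal steps rely
    on. *)
Lemma subgradient_minimizer : subgradient h xs (- gradient f xs).
Proof.
apply: (subgradient_of_min hproper hconvex dxs fine_minimizer (k := L / 2)).
by move=> d; exact: smooth_upper.
Qed.

(** Strong convexity of h for the subgradient at xs and convexity of f are added; the gradient terms
    cancel. *)
Lemma quadratic_growth u : (h u < +oo)%E ->
  dot (u - xs) (u - xs) <= 2 / mu * gap u.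
Proof.
move=> du.
have H1 := strongly_convex_fine hproper hmu subgradient_minimizer dxs du.
have H2 := convex_gradient_le xs u.
rewrite -[2 / mu]invf_div ler_pdivlMl ?divr_gt0 //.
by move: H1 H2; rewrite /gap dotNl; lra.
Qed.

Lemma gap_convex (t : R) u v : (h u < +oo)%E -> (h v < +oo)%E -> 0 <= t -> t <= 1 ->
  (h (t *: u + (1 - t) *: v)%R < +oo)%E /\
  gap (t *: u + (1 - t) *: v) <= t * gap u + (1 - t) * gap v.
Proof.
move=> du dv t0 t1.
have [dt ht] := convex_fine hproper hconvex du dv t0 t1.
by split=> //; have := convex_functionP u v t0 t1; rewrite /gap; lra.
Qed.

(* Coupling of the gradient step [y] and the mirror step [z]: [y] is compared
   with the point obtained from [x] by replacing [z0] with [z]. *)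
Lemma coupled_prox_step (tau alpha : R) (xt y0 z0 g : 'rV[R]_N) :
  0 < L -> 0 < tau -> tau <= 1 / 2 -> alpha = (3 * tau * L)^-1 ->
  (h xt < +oo)%E -> (h y0 < +oo)%E -> (h z0 < +oo)%E ->
  let x := tau *: z0 + tau *: xt + (1 - tau - tau) *: y0 in
  let e := g - gradient f x in
  let y := argmin (fun u => ((dot g u + 3 * L / 2 * enorm (u - x) ^+ 2)%:E + h u)%E) in
  let z := argmin (fun u => ((dot g u + (2 * alpha)^-1 * enorm (u - z0) ^+ 2)%:E + h u)%E) in
  [/\ (h y < +oo)%E, (h z < +oo)%E &
  gap y + tau * (3 / 2 * tau * L + mu / 2) * dot (z - xs) (z - xs) <=
  tau * gap xt + (1 - 2 * tau) * gap y0
  + tau * (3 / 2 * tau * L) * dot (z0 - xs) (z0 - xs)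
  + dot e e / (4 * L) + tau * dot e (xs - z0)].
Proof.
move=> L0 tau0 tau2 alphaE dxt dy0 dz0 x e y z.
have tau2' : 0 <= 1 - 2 * tau by lra.
have tau1 : 0 < 1 - tau by lra.
have tau1' : tau <= 1 by lra.
have low1 := convex_gradient_le x xt.
have low2 := convex_gradient_le x y0.
have low3 := convex_gradient_le x xs.
(* [tau (xs - z0)] is a combination of differences with [x]. *)
have xE : tau * dot (gradient f x) (xs - z0) = tau * dot (gradient f x) (xs - x)
    + tau * dot (gradient f x) (xt - x) + (1 - 2 * tau) * dot (gradient f x) (y0 - x).
  rewrite /x !dotE; ring.
have lowc : f x + tau * dot (gradient f x) (xs - z0) <=
    tau * f xs + tau * f xt + (1 - 2 * tau) * f y0.
  rewrite xE; have := ler_wpM2l (ltW tau0) low3; have := ler_wpM2l (ltW tau0) low1.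
  by have := ler_wpM2l tau2' low2; lra.
clear low1 low2 low3 xE.
have k1 : 0 < 3 * L / 2 by rewrite divr_gt0 // mulr_gt0.
have alpha2 : (2 * alpha)^-1 = 3 / 2 * tau * L.
  by rewrite alphaE; field; rewrite gt_eqF //= gt_eqF.
have k2 : 0 < (2 * alpha)^-1 by rewrite alpha2 !mulr_gt0 // divr_gt0.
have [dy Hy] := prox_ineq hproper hconvex hclosed dxs subgradient_minimizer g x k1 hmu.
have [dz Hz] := prox_ineq hproper hconvex hclosed dxs subgradient_minimizer g z0 k2 hmu.
rewrite -/y in dy Hy; rewrite -/z in dz Hz; split => //.
(* Convexity is available for two points, so the combination of three is nested; tau <= 1/2 keeps
   the inner weight at most 1. *)
pose v := tau *: z + (1 - tau) *: ((tau / (1 - tau)) *: xt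
  + (1 - tau / (1 - tau)) *: y0).
have s0 : 0 <= tau / (1 - tau) by rewrite divr_ge0 // ltW.
have s1 : tau / (1 - tau) <= 1 by rewrite ler_pdivrMr //; move: tau2'; lra.
have [dv1 hv1] := convex_fine hproper hconvex dxt dy0 s0 s1.
have [dv hv] := convex_fine hproper hconvex dz dv1 (ltW tau0) tau1'.
rewrite -/v in dv hv.
have tau1N : 1 - tau != 0 by rewrite gt_eqF.
have hv' : fine (h v) <= tau * fine (h z) + tau * fine (h xt)
    + (1 - 2 * tau) * fine (h y0).
  apply: le_trans hv _; rewrite -addrA lerD2l.
  apply: le_trans (ler_wpM2l (ltW tau1) hv1) _.
  by rewrite le_eqVlt; apply/orP; left; apply/eqP; field.
have vE : v = x + tau *: (z - z0).
  rewrite /v /x scalerDr !scalerA.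
  have -> : (1 - tau) * (tau / (1 - tau)) = tau by field.
  have -> : (1 - tau) * (1 - tau / (1 - tau)) = 1 - tau - tau by field.
  by rewrite scalerBr [RHS]addrC -!addrA addKr.
have Hyv := Hy _ dv.
have Hzs := Hz _ dxs.
(* The surplus of the proximal inequality for y is dropped; only that for z is kept. *)
have mu2 : 0 <= (3 * L / 2 + mu / 2) * dot (v - y) (v - y).
  by rewrite mulr_ge0 ?dot_ge0 // addr_ge0 ?divr_ge0 ?ltW // mulr_gt0.
have gE : g = gradient f x + e by rewrite /e addrC subrK.
have Hyv' : fine (h y) + dot g (y - x) + 3 * L / 2 * dot (y - x) (y - x) <=
    fine (h v) + tau * dot g (z - z0)
    + 3 * L / 2 * (tau ^+ 2 * dot (z - z0) (z - z0)).
  have vx : v - x = tau *: (z - z0) by rewrite vE addrC addKr.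
  have gy : dot g y = dot g (y - x) + dot g x by rewrite (dotDr y) (dotNr x) subrK.
  have gv : dot g v = tau * dot g (z - z0) + dot g x by rewrite vE (dotDr x) (dotZr tau) addrC.
  have vv : dot (v - x) (v - x) = tau ^+ 2 * dot (z - z0) (z - z0).
    by rewrite vx dotZl dotZr mulrA.
  by rewrite vv gy gv in Hyv; exact: cancel_common_term Hyv mu2.
have Hzs' : fine (h z) + dot g (z - z0) + 3 / 2 * tau * L * dot (z - z0) (z - z0)
    + (3 / 2 * tau * L + mu / 2) * dot (z - xs) (z - xs) <=
    fine (h xs) + dot g (xs - z0) + 3 / 2 * tau * L * dot (z0 - xs) (z0 - xs).
  have sq (u w : 'rV[R]_N) : dot (u - w) (u - w) = dot (w - u) (w - u).
    by rewrite -opprB dotNl dotNr opprK.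
  have gz : dot g (z - z0) = dot g z - dot g z0 by rewrite (dotDr z) (dotNr z0).
  have gs : dot g (xs - z0) = dot g xs - dot g z0 by rewrite (dotDr xs) (dotNr z0).
  rewrite alpha2 (sq xs z) (sq xs z0) in Hzs; rewrite gz gs.
  exact: subtract_common_term Hzs.
have Hzs'' := ler_wpM2l (ltW tau0) Hzs'.
clear mu2 Hyv Hzs.
have up := smooth_upper x (y - x) df fL.
rewrite [x + _]addrC subrK in up.
have L2 : 0 < 2 * L by rewrite mulr_gt0.
(* The parameter 2L yields L |y - x|^2, exactly what smoothness leaves of the coefficient 3L/2. *)
have young := @dot_young _ _ (2 * L) (- e) (y - x) L2.
rewrite mulrA in young.
have gyx : dot g (y - x) = dot (gradient f x) (y - x) + dot e (y - x).
  by rewrite {1}gE dotDl.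
have gxz : dot g (xs - z0) = dot (gradient f x) (xs - z0) + dot e (xs - z0).
  by rewrite {1}gE dotDl.
rewrite dotNl dotNl dotNr opprK in young.
have e4 : dot e e / (2 * 2 * L) = dot e e / (4 * L) by rewrite -natrM.
rewrite e4 in young; rewrite gyx in Hyv'; rewrite gxz in Hzs''.
exact: coupled_step_arith up young lowc Hyv' Hzs'' hv'.
Qed.

End ConvexSmooth.

(** * Geometrically weighted inner loops and contraction over outer loops *)

Section NestedLoop.
Context {R : realType} {V : lmodType R}.
Variables (T : finType) (dom : V -> Prop) (a d : V -> R).
Variables (step : V -> V * V -> T -> V * V) (theta p beta gam rho : R) (m : nat).
Hypotheses (T_gt0 : (0 < #|T|)%N) (m_gt0 : (0 < m)%N).
Hypotheses (theta_gt0 : 0 < theta) (p_ge0 : 0 <= p) (beta_ge0 : 0 <= beta)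
  (gam_ge0 : 0 <= gam) (beta_theta : theta ^+ m * p <= 1 - beta * theta)
  (rho_theta : 1 <= rho * theta ^+ m).
Hypotheses (a_ge0 : forall u, dom u -> 0 <= a u) (d_ge0 : forall u, 0 <= d u).
Hypothesis a_convex : forall t u v, dom u -> dom v -> 0 <= t -> t <= 1 ->
  dom (t *: u + (1 - t) *: v) /\ a (t *: u + (1 - t) *: v) <= t * a u + (1 - t) * a v.
Hypothesis step_dom : forall xt yz t, dom xt -> dom yz.1 -> dom yz.2 ->
  dom (step xt yz t).1 /\ dom (step xt yz t).2.
Hypothesis step_avg : forall xt yz, dom xt -> dom yz.1 -> dom yz.2 ->
  avg (fun t => a (step xt yz t).1 + theta * gam * d (step xt yz t).2) <=
  p * a xt + beta * a yz.1 + gam * d yz.2.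

(** Induction on the number of points: the mean of the first ones is combined with the new one with
    weight W'/W. *)
Lemma weighted_jensen n (w : nat -> R) (v : nat -> V) :
  (forall j, 0 < w j) -> (forall j, (j <= n)%N -> dom (v j)) ->
  let W := \sum_(j < n.+1) w j in
  dom (W^-1 *: \sum_(j < n.+1) w j *: v j) /\
  W * a (W^-1 *: \sum_(j < n.+1) w j *: v j) <= \sum_(j < n.+1) w j * a (v j).
Proof.
move=> w0; elim: n => [|n IH] vdom W.
  rewrite /W !big_ord_recl !big_ord0 !addr0 scalerA mulVf ?gt_eqF // scale1r.
  by split=> //; exact: vdom.
have [|dv av] := IH; first by move=> j jn; exact: vdom (leqW jn).
pose W' := \sum_(j < n.+1) w j; rewrite -/W' in dv av.
have WE : W = W' + w n.+1 by rewrite /W big_ord_recr.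
have W'0 : 0 < W'.
  rewrite /W' big_ord_recl; apply: ltr_wpDr => //.
  by apply: sumr_ge0 => j _; exact: ltW.
have W0 : 0 < W by rewrite WE addr_gt0.
set u := W'^-1 *: _ in dv av.
have t0 : 0 <= W' / W by rewrite divr_ge0 // ltW.
have t1 : W' / W <= 1 by rewrite ler_pdivrMr // mul1r WE lerDl ltW.
have tC : 1 - W' / W = w n.+1 / W.
  by rewrite -[X in X - _](@divff _ W) ?gt_eqF // -mulrBl WE addrAC subrr add0r.
have [dt at_] := a_convex dv (vdom n.+1 (leqnn _)) t0 t1.
have E : W^-1 *: \sum_(j < n.+2) w j *: v j =
    W' / W *: u + (1 - W' / W) *: v n.+1.
  rewrite big_ord_recr scalerDr /u tC !scalerA; congr (_ + _); last by rewrite mulrC.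
  by rewrite mulrAC divff ?mul1r // gt_eqF.
rewrite E; split=> //; rewrite big_ord_recr /=.
apply: le_trans (ler_wpM2l (ltW W0) at_) _; rewrite tC mulrDr !mulrA.
rewrite (mulrC W W') (mulrC W (w _)) !mulfK ?gt_eqF //.
by rewrite lerD2r.
Qed.

(** The default [yz] of [nth] also lies in the domain, so the claim holds for every j. *)
Lemma scanl_dom xt yz (s : seq T) : dom xt -> dom yz.1 -> dom yz.2 ->
  forall j, dom (nth yz (scanl (step xt) yz s) j).1 /\
            dom (nth yz (scanl (step xt) yz s) j).2.
Proof.
move=> dxt dy dz; suff H : forall yz0 j, dom yz0.1 /\ dom yz0.2 ->
    dom (nth yz (scanl (step xt) yz0 s) j).1 /\
    dom (nth yz (scanl (step xt) yz0 s) j).2 by move=> j; exact: H.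
elim: s => [|t s IH] yz0 j [dy0 dz0] /=; first by rewrite nth_nil.
have st := step_dom t dxt dy0 dz0.
by case: j => [|j] //=; exact: IH.
Qed.

(** The j-th step inequality is weighted by theta^j. The terms in d telescope, and each intermediate
    y keeps theta^j - beta theta^(j+1), the origin of the factor 1 - beta theta; the last y keeps
    its beta term. The induction peels off the first draw. *)
Lemma inner_loop_avg n xt yz : dom xt -> dom yz.1 -> dom yz.2 ->
  avg (fun w : n.-tuple T =>
    (1 - beta * theta) *
      (\sum_(j < n) theta ^+ j * a (nth yz (scanl (step xt) yz w) j).1)
    + theta ^+ n * (beta * a (last yz (scanl (step xt) yz w)).1
                    + gam * d (last yz (scanl (step xt) yz w)).2)) <=
  p * a xt * (\sum_(j < n) theta ^+ j) + beta * a yz.1 + gam * d yz.2.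
Proof.
move=> dxt; elim: n yz => [|n IH] yz dy dz.
  by rewrite avg_tuple0 !big_ord0 /= !mulr0 !add0r expr0 mul1r.
rewrite avg_tupleS; set Th := \sum_(j < n) theta ^+ j.
have ThS : \sum_(j < n.+1) theta ^+ j = 1 + theta * Th.
  by rewrite big_ord_recl mulr_sumr; congr (_ + _); apply: eq_bigr => j _; rewrite exprS.
apply: (le_trans (y := avg (fun t => (a (step xt yz t).1
    + theta * gam * d (step xt yz t).2) + theta * (p * a xt * Th)))); last first.
  by rewrite avgD avg_cst // ThS; have := step_avg dxt dy dz; lra.
apply: ler_avg => t; have [dy1 dz1] := step_dom t dxt dy dz.
set yz1 := step xt yz t.
pose W (w : n.-tuple T) := (1 - beta * theta) *
      (\sum_(j < n) theta ^+ j * a (nth yz1 (scanl (step xt) yz1 w) j).1)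
    + theta ^+ n * (beta * a (last yz1 (scanl (step xt) yz1 w)).1
                    + gam * d (last yz1 (scanl (step xt) yz1 w)).2).
have E (w : n.-tuple T) : (1 - beta * theta) *
      (\sum_(j < n.+1) theta ^+ j * a (nth yz (scanl (step xt) yz (t :: w)) j).1)
    + theta ^+ n.+1 * (beta * a (last yz (scanl (step xt) yz (t :: w))).1
                    + gam * d (last yz (scanl (step xt) yz (t :: w))).2) =
    (1 - beta * theta) * a yz1.1 + theta * W w.
  rewrite big_ord_recl /= -/yz1 expr0 mul1r /W.
  have -> : \sum_(j < n) theta ^+ (bump 0 j) * a (nth yz (scanl (step xt) yz1 w) j).1 =
      theta * \sum_(j < n) theta ^+ j * a (nth yz1 (scanl (step xt) yz1 w) j).1.
    rewrite mulr_sumr; apply: eq_bigr => j _; rewrite exprS mulrA.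
    by rewrite (set_nth_default yz1) // size_scanl size_tuple.
  by rewrite exprS; ring.
under [X in avg X]eq_fun => w do rewrite /= E.
rewrite avgD avg_cst ?card_tuple_gt0 // avgZ.
have := ler_wpM2l (ltW theta_gt0) (IH yz1 dy1 dz1).
rewrite -/Th -/W; lra.
Qed.

Definition nested_outer (st : V * (V * V)) (w : m.-tuple T) : V * (V * V) :=
  ((\sum_(j < m) theta ^+ j)^-1 *:
     \sum_(j < m) theta ^+ j *: (nth st.2 (scanl (step st.1) st.2 w) j).1,
   last st.2 (scanl (step st.1) st.2 w)).

Let Theta := \sum_(j < m) theta ^+ j.

(** The weights reproduce the right-hand side of [inner_loop_avg] for n = m. *)
Definition potential (st : V * (V * V)) : R :=
  p * Theta * a st.1 + beta * a st.2.1 + gam * d st.2.2.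

Definition dom_state (st : V * (V * V)) := [/\ dom st.1, dom st.2.1 & dom st.2.2].

Let Theta_gt0 : 0 < Theta.
Proof.
rewrite /Theta -(prednK m_gt0) big_ord_recl expr0.
apply: ltr_wpDr; last exact: ltr01.
by apply: sumr_ge0 => j _; rewrite exprn_ge0 // ltW.
Qed.

Lemma potential_ge0 st : dom_state st -> 0 <= potential st.
Proof.
case=> dxt dy _; rewrite /potential !addr_ge0 //.
- by rewrite !mulr_ge0 ?a_ge0 // ltW.
- by rewrite mulr_ge0 ?a_ge0.
- by rewrite mulr_ge0.
Qed.

Lemma nested_outer_jensen st w : dom_state st -> dom_state (nested_outer st w) /\
  Theta * a (nested_outer st w).1 <=
  \sum_(j < m) theta ^+ j * a (nth st.2 (scanl (step st.1) st.2 w) j).1.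
Proof.
case: st => xt yz [dxt dy dz] /=.
have dnth := scanl_dom w dxt dy dz.
have th0 j : 0 < theta ^+ j by exact: exprn_gt0.
have := @weighted_jensen m.-1 (fun j => theta ^+ j)
  (fun j => (nth yz (scanl (step xt) yz w) j).1) th0 (fun j _ => (dnth j).1).
rewrite (prednK m_gt0) => -[dx ax]; split; last exact: ax.
split; [exact: dx | |] => /=; rewrite -nth_last; apply dnth.
Qed.

(** By [beta_theta] and Jensen, theta^m times the new potential is at most the left-hand side of
    [inner_loop_avg]; [rho_theta] then turns theta^m into the factor rho. *)
Lemma outer_loop_avg st : dom_state st ->
  avg (fun w => potential (nested_outer st w)) <= rho * potential st.
Proof.
move=> dst; have rho0 : 0 <= rho.
  rewrite -(@pmulr_lge0 _ (theta ^+ m)) ?exprn_gt0 //.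
  exact: le_trans rho_theta.
have H : avg (fun w => theta ^+ m * potential (nested_outer st w)) <= potential st.
  case: (dst) => dxt dy dz; have := inner_loop_avg m dxt dy dz.
  rewrite -/Theta => H; apply: le_trans (le_trans H _); last first.
    by rewrite /potential le_eqVlt; apply/orP; left; apply/eqP; ring.
  apply: ler_avg => w; have [[dxt' _ _] J] := nested_outer_jensen w dst.
  rewrite /potential -addrA mulrDr lerD2r.
  have b0 : 0 <= 1 - beta * theta by apply: le_trans beta_theta; rewrite mulr_ge0 ?exprn_ge0 // ltW.
  apply: le_trans (ler_wpM2l b0 J).
  rewrite !mulrA -!(mulrA _ Theta) ler_wpM2r // mulr_ge0 ?a_ge0 // ltW //.
rewrite avgZ in H.
have Q0 : 0 <= avg (fun w => potential (nested_outer st w)).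
  rewrite -[leLHS](avg_cst 0 (card_tuple_gt0 m T_gt0)); apply: ler_avg => w.
  by apply: potential_ge0; case: (nested_outer_jensen w dst).
apply: le_trans (ler_wpM2l rho0 H); rewrite mulrA.
by rewrite ler_peMl.
Qed.

Lemma nested_loop_dom S st (w : S.-tuple (m.-tuple T)) : dom_state st ->
  dom_state (foldl nested_outer st w).
Proof.
case: w => s _ /=; elim: s st => [|t s IH] st dst //=.
by apply: IH; case: (nested_outer_jensen t dst).
Qed.

(** Only the first term of the final potential is kept; the contraction is iterated by peeling off
    the first outer loop. *)
Lemma nested_loop_avg S st : dom_state st ->
  p * Theta * avg (fun w : S.-tuple (m.-tuple T) => a (foldl nested_outer st w).1) <=
  rho ^+ S * potential st.
Proof.
have rho0 : 0 <= rho.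
  rewrite -(@pmulr_lge0 _ (theta ^+ m)) ?exprn_gt0 //.
  exact: le_trans rho_theta.
move=> dst; apply: (le_trans (y := avg (fun w : S.-tuple (m.-tuple T) =>
    potential (foldl nested_outer st w)))).
  rewrite -avgZ; apply: ler_avg => w.
  have [_ dy dz] := nested_loop_dom w dst.
  by rewrite /potential -addrA lerDl addr_ge0 // mulr_ge0 // a_ge0.
elim: S st dst => [|S IH] st dst; first by rewrite avg_tuple0 expr0 mul1r.
rewrite avg_tupleS exprSr -mulrA.
apply: le_trans (ler_wpM2l (exprn_ge0 S rho0) (outer_loop_avg dst)).
rewrite -avgZ; apply: ler_avg => t; apply: IH.
by case: (nested_outer_jensen t dst).
Qed.

End NestedLoop.

(** * Bernoulli-type bounds for the powers of theta *)

Lemma bernoulli_ge (R : realFieldType) (x : R) n : 0 <= x -> 1 + n%:R * x <= (1 + x) ^+ n.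
Proof.
move=> x0; elim: n => [|n IH]; first by rewrite mul0r addr0 expr0.
rewrite exprS -natr1; apply: (le_trans (y := (1 + x) * (1 + n%:R * x))).
  by have := mulr_ge0 (ler0n R n) (sqr_ge0 x); lra.
by rewrite ler_wpM2l // addr_ge0.
Qed.

(** Division-free form of (1 + x)^n <= 1 / (1 - n x); the induction uses (1 + x)(1 - (n + 1) x) <= 1
    - n x. *)
Lemma bernoulli_le (R : realFieldType) (x : R) n :
  0 <= x -> (1 + x) ^+ n * (1 - n%:R * x) <= 1.
Proof.
move=> x0; elim: n => [|n IH]; first by rewrite expr0 mul0r subr0 mulr1.
apply: le_trans IH; rewrite exprSr -mulrA ler_wpM2l ?exprn_ge0 ?addr_ge0 //.
by rewrite -natr1; have := mulr_ge0 (ler0n R n) (sqr_ge0 x); have := sqr_ge0 x; lra.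
Qed.

(** * Scalar estimates that fix the constants of one averaged step *)

Section StepArithmetic.
Context {R : realType}.
Variables (tau L mu : R).
Hypotheses (tau_gt0 : 0 < tau) (tau_le : tau <= 1 / 2) (L_gt0 : 0 < L) (mu_gt0 : 0 < mu)
  (mu_tauL : mu <= 3 * tau * L) (tau2L : tau ^+ 2 * L <= mu).

(** With mu/L <= 3 tau the left side is at most (1/240 + 1/90) tau mu = 11/720 tau mu, just below
    tau mu / 64. *)
Lemma noise_coef_le :
  (1 / (4 * L) + 2 * tau / mu) * (mu ^+ 2 / 180) <= tau * mu / 64.
Proof.
have -> : (1 / (4 * L) + 2 * tau / mu) * (mu ^+ 2 / 180) =
    mu / 720 * (mu / L) + tau * mu / 90.
  by field; rewrite !gt_eqF.
have : mu / L <= 3 * tau by rewrite ler_pdivrMr.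
move/(ler_wpM2l (ltW mu_gt0)).
by have := mulr_gt0 tau_gt0 mu_gt0; lra.
Qed.

(** The room between mu/8 and mu/2 pays both for the factor theta = 1 + tau/6 and for the noise;
    tau^2 L <= mu limits the growth of the leading term to mu/4. *)
Lemma mirror_coef_le : (1 + tau / 6) *
    (tau * (3 / 2 * tau * L + mu / 8) + tau ^+ 2 * mu / 32) <=
  tau * (3 / 2 * tau * L + mu / 2).
Proof.
have H1 : tau * mu <= 1 / 2 * mu by rewrite ler_wpM2r // ltW.
have H2 : tau ^+ 2 * mu <= 1 / 4 * mu.
  rewrite expr2 -mulrA; apply: le_trans (ler_wpM2l (ltW tau_gt0) H1) _; lra.
have -> : (1 + tau / 6) * (tau * (3 / 2 * tau * L + mu / 8) + tau ^+ 2 * mu / 32) =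
  tau * ((1 + tau / 6) * (3 / 2 * tau * L + mu / 8 + tau * mu / 32)) by field.
apply: ler_wpM2l; first exact: ltW.
by move: H1 H2 tau2L mu_gt0; lra.
Qed.

(** Young with parameter mu/4 on the error product adds tau mu/8 to the coefficient of [d0] and 2
    tau/mu to that of [ee]. *)
Lemma step_arith (gy' dz' axt ay d0 ee exz : R) :
  gy' + tau * (3 / 2 * tau * L + mu / 2) * dz' <= tau * axt + (1 - 2 * tau) * ay
    + tau * (3 / 2 * tau * L) * d0 + ee / (4 * L) + tau * exz ->
  exz <= ee / (2 * (mu / 4)) + mu / 4 / 2 * d0 ->
  gy' + tau * (3 / 2 * tau * L + mu / 2) * dz' <= tau * axt + (1 - 2 * tau) * ay
    + tau * (3 / 2 * tau * L + mu / 8) * d0 + (1 / (4 * L) + 2 * tau / mu) * ee.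
Proof.
have -> : ee / (2 * (mu / 4)) = 2 / mu * ee by field; rewrite gt_eqF.
move=> H1 /(ler_wpM2l (ltW tau_gt0)).
have -> : (1 / (4 * L) + 2 * tau / mu) * ee = ee / (4 * L) + tau * (2 / mu * ee).
  by field; rewrite !gt_eqF.
by move: H1; lra.
Qed.

(** The noise tau mu/64 D splits into tau^2 mu/32 d0, absorbed by the mirror term, and tau/16 (ay +
    axt), which turns tau into 17/16 tau and 1 - 2 tau into 1 - 31/16 tau. *)
Lemma noise_absorbed (axt ay d0 D : R) : 0 <= d0 -> 0 <= D ->
  D <= 2 * tau * d0 + 4 / mu * (ay + axt) ->
  tau * axt + (1 - 2 * tau) * ay + tau * (3 / 2 * tau * L + mu / 8) * d0
    + (1 / (4 * L) + 2 * tau / mu) * (mu ^+ 2 / 180 * D) <=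
  17 / 16 * tau * axt + (1 - 31 / 16 * tau) * ay +
    tau * (3 / 2 * tau * L + mu / 2) / (1 + tau / 6) * d0.
Proof.
move=> d00 D0 HD.
have th : 0 < 1 + tau / 6 by rewrite addr_gt0 // divr_gt0.
have H1 : tau * (3 / 2 * tau * L + mu / 8) + tau ^+ 2 * mu / 32 <=
    tau * (3 / 2 * tau * L + mu / 2) / (1 + tau / 6).
  by rewrite ler_pdivlMr // mulrC; exact: mirror_coef_le.
have H2 := ler_wpM2r d00 H1.
have H3 := ler_wpM2r D0 noise_coef_le.
have c0 : 0 <= tau * mu / 64 by rewrite divr_ge0 // mulr_ge0 // ltW.
have H4 := ler_wpM2l c0 HD.
have E : tau * mu / 64 * (2 * tau * d0 + 4 / mu * (ay + axt)) =
    tau ^+ 2 * mu / 32 * d0 + tau / 16 * (ay + axt) by field; rewrite gt_eqF.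
rewrite E in H4; move: H2 H3 H4; rewrite mulrA.
set c := _ / (1 + tau / 6); set k := 1 / (4 * L) + _; lra.
Qed.

End StepArithmetic.

(** * Distance from the extrapolated point to the snapshot *)

Section Distance.
Context {R : realType} {N : nat}.

(** x - xt is tau (z - xt) + (1 - 2 tau)(y - xt), with weights of sum at most 1; convexity of the
    squared norm applies, then both differences are split at xs. *)
Lemma three_point_distance (tau : R) (xt y z xs x : 'rV[R]_N) :
  0 <= tau -> tau <= 1 / 2 ->
  x = tau *: z + tau *: xt + (1 - tau - tau) *: y ->
  dot (x - xt) (x - xt) <= 2 * tau * dot (z - xs) (z - xs)
    + 2 * dot (y - xs) (y - xs) + 2 * dot (xt - xs) (xt - xs).
Proof.
move=> tau0 tau2 xE; set p := z - xs; set q := y - xs; set r := xt - xs.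
have -> : x - xt = tau *: (p - r) + (1 - 2 * tau) *: (q - r).
  apply/rowP => i; rewrite xE /p /q /r !mxE; ring.
clearbody p q r; have P := dot_sqrD_le2 p (- r); have Q := dot_sqrD_le2 q (- r).
move: (p - r) (q - r) P Q => P' Q' HP HQ; rewrite !dotNl !dotNr !opprK in HP HQ.
have t1 : 0 <= 1 - 2 * tau by lra.
have c1 : 0 <= tau * (1 - 2 * tau) by exact: mulr_ge0.
have H1 := mulr_ge0 c1 (dot_ge0 (P' - Q')).
have H2 := mulr_ge0 (mulr_ge0 tau0 tau0) (dot_ge0 P').
have H3 := mulr_ge0 c1 (dot_ge0 Q').
have HP' := ler_wpM2l tau0 HP; have HQ' := ler_wpM2l t1 HQ.
have H4 := mulr_ge0 tau0 (dot_ge0 q).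
have H5 := mulr_ge0 tau0 (dot_ge0 r).
rewrite !dotE (dotC Q' P') in H1 *.
clear HP HQ; lra.
Qed.

End Distance.

(** * Linear convergence in mean for the prescribed parameters *)

Section SoCKConvergence.
Context {R : realType} {N1 N2 n1 n2 : nat}.
Variables (F : 'I_n1 -> 'rV[R]_N1 -> R) (G : 'I_n2 -> 'rV[R]_N2 -> 'rV[R]_N1)
  (h : 'rV[R]_N2 -> \bar R) (mu L LF BF LG BG : R) (xs : 'rV[R]_N2).
Hypotheses (n1_gt0 : (0 < n1)%N) (n2_gt0 : (0 < n2)%N)
  (dF : forall i x, differentiable (F i) x) (dG : forall j x, differentiable (G j) x)
  (hproper : proper_fun h) (hclosed : closed_fun h) (hconvex : convex_efun h)
  (fconvex : convex_function setT (fcomp F G))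
  (mu_gt0 : 0 < mu) (hmu : strongly_convex mu h)
  (hLF : forall i, smooth_fun LF (F i)) (hBF : forall i, bounded_gradient BF (F i))
  (hLG : forall j, smooth_map LG (G j)) (hBG : forall j, bounded_Jac BG (G j))
  (hL : forall i j x y,
     enorm (gradient (F i) (Gavg G x) *m Jac (G j) x
            - gradient (F i) (Gavg G y) *m Jac (G j) y) <= L * enorm (x - y))
  (L_gt0 : 0 < L) (xsmin : is_minimizer (Hobj F G h) xs) (dxs : (h xs < +oo)%E).
Variables (m A B C : nat) (tau theta alpha : R).
Hypotheses (m_gt0 : (0 < m)%N) (A_gt0 : (0 < A)%N) (B_gt0 : (0 < B)%N) (C_gt0 : (0 < C)%N)
  (tauE : tau = (2 * m%:R)^-1) (thetaE : theta = 1 + (12 * m%:R)^-1)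
  (alphaE : alpha = (3 * tau * L)^-1)
  (mu_tauL : mu <= 3 * tau * L) (tau2L : tau ^+ 2 * L <= mu)
  (A_ge : 2160 * BG ^+ 4 * LF ^+ 2 / mu ^+ 2 <= A%:R)
  (B_ge : 2160 * BF ^+ 2 * LG ^+ 2 / mu ^+ 2 <= B%:R)
  (C_ge : 1080 * L ^+ 2 / mu ^+ 2 <= C%:R).

Local Notation f := (fcomp F G).
Local Notation a := (gap f h xs).
Local Notation dist u := (dot (u - xs) (u - xs)).
Let dom u := (h u < +oo)%E.
Let step := inner_step F G h L alpha tau tau (A := A) (B := B) (C := C).

Let m_gt0R : 0 < m%:R :> R. Proof. by rewrite ltr0n. Qed.

Let tau_gt0 : 0 < tau. Proof. by rewrite tauE invr_gt0 mulr_gt0. Qed.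

Let tau_m : tau * m%:R = 1 / 2.
Proof. by rewrite tauE; field; rewrite gt_eqF. Qed.

Let tau_le : tau <= 1 / 2.
Proof. by rewrite -tau_m ler_peMr ?ler1n // ltW. Qed.

Let thetaE' : theta = 1 + tau / 6.
Proof. by rewrite thetaE tauE; field; rewrite gt_eqF. Qed.

Let theta_ge1 : 1 <= theta. Proof. by rewrite thetaE' lerDl divr_ge0 // ltW. Qed.

Let theta_gt0 : 0 < theta. Proof. exact: lt_le_trans theta_ge1. Qed.

Let tau6 : 0 <= tau / 6. Proof. by rewrite divr_ge0 // ltW. Qed.

Let m_tau6 : m%:R * (tau / 6) = 1 / 12.
Proof. by rewrite mulrA (mulrC _ tau) tau_m; field. Qed.

Lemma theta_expm_ge : 13 / 12 <= theta ^+ m.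
Proof. by have := bernoulli_ge m tau6; rewrite m_tau6 -thetaE'; lra. Qed.

Lemma theta_expm_le : theta ^+ m <= 12 / 11.
Proof. by have := bernoulli_le m tau6; rewrite m_tau6 -thetaE'; lra. Qed.

Lemma sample_error_le (X : R) (k : nat) (c : R) : 0 < c -> (0 < k)%N ->
  c * X / mu ^+ 2 <= k%:R -> X / k%:R <= mu ^+ 2 / c.
Proof.
move=> c0 k0; rewrite ler_pdivrMr ?exprn_gt0 // => H.
by rewrite ler_pdivrMr ?ltr0n // mulrAC ler_pdivlMr // mulrC (mulrC _ k%:R).
Qed.

Let fL := gradient_fcomp_lipschitz dF dG hL n1_gt0 n2_gt0.
Let df := differentiable_fcomp dF dG.

(** The three sampling errors contribute equally: 4/2160 + 4/2160 + 2/1080 = 1/180. *)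
Lemma avg_noise_le (xt x : 'rV[R]_N2) :
  avg (fun d : draw n1 n2 A B C =>
    dot (grad_est F G d xt x - gradient f x) (grad_est F G d xt x - gradient f x))
  <= mu ^+ 2 / 180 * dot (x - xt) (x - xt).
Proof.
apply: le_trans (avg_grad_est_error_le dF dG hL n1_gt0 n2_gt0 hLF hBF hLG hBG
  A_gt0 B_gt0 C_gt0 xt x) _.
rewrite ler_wpM2r ?dot_ge0 //.
have eA : BG ^+ 4 * LF ^+ 2 / A%:R <= mu ^+ 2 / 2160.
  by apply: (sample_error_le _ A_gt0); [rewrite ltr0n | rewrite (mulrA 2160)].
have eB : BF ^+ 2 * LG ^+ 2 / B%:R <= mu ^+ 2 / 2160.
  by apply: (sample_error_le _ B_gt0); [rewrite ltr0n | rewrite (mulrA 2160)].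
have eC : L ^+ 2 / C%:R <= mu ^+ 2 / 1080 by apply: (sample_error_le _ C_gt0 C_ge); rewrite ltr0n.
by move: eA eB eC; lra.
Qed.

(** Valid for every single draw: the product of e with xs - z is bounded by Young's inequality
    instead of being averaged away. *)
Lemma step_properties xt yz d : dom xt -> dom yz.1 -> dom yz.2 ->
  let x := tau *: yz.2 + tau *: xt + (1 - tau - tau) *: yz.1 in
  let e := grad_est F G d xt x - gradient f x in
  [/\ dom (step xt yz d).1, dom (step xt yz d).2 &
  a (step xt yz d).1
    + tau * (3 / 2 * tau * L + mu / 2) * dist (step xt yz d).2 <=
  tau * a xt + (1 - 2 * tau) * a yz.1
    + tau * (3 / 2 * tau * L + mu / 8) * dist yz.2
    + (1 / (4 * L) + 2 * tau / mu) * dot e e].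
Proof.
case: yz => y z dxt dy dz x e.
have [dy' dz' H] := coupled_prox_step df fL fconvex hproper hconvex hclosed hmu mu_gt0
  dxs xsmin (grad_est F G d xt x) L_gt0 tau_gt0 tau_le alphaE dxt dy dz.
split=> //; apply: step_arith H _ => //.
have sq : dist z = dot (xs - z) (xs - z) by rewrite -opprB dotNl dotNr opprK.
by rewrite [(_, z).2]/= sq; apply: dot_young; rewrite divr_gt0.
Qed.

Let card_draw_gt0 : (0 < #|draw n1 n2 A B C|)%N.
Proof.
by rewrite !card_prod !muln_gt0 !card_tuple_gt0 // card_ord.
Qed.

(** The weight of the squared distance is divided by theta on the right, so that the sum weighted by
    theta^j telescopes. *)
Lemma step_avg_le xt yz : dom xt -> dom yz.1 -> dom yz.2 ->
  avg (fun d => a (step xt yz d).1 + theta *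
    (tau * (3 / 2 * tau * L + mu / 2) / theta) * dist (step xt yz d).2) <=
  17 / 16 * tau * a xt + (1 - 31 / 16 * tau) * a yz.1
  + tau * (3 / 2 * tau * L + mu / 2) / theta * dist yz.2.
Proof.
move=> dxt dy dz.
pose x := tau *: yz.2 + tau *: xt + (1 - tau - tau) *: yz.1.
have growth := quadratic_growth df fL fconvex hproper hconvex hmu mu_gt0 dxs xsmin.
have Dle : dot (x - xt) (x - xt) <= 2 * tau * dist yz.2 + 4 / mu * (a yz.1 + a xt).
  apply: le_trans (three_point_distance xs (ltW tau_gt0) tau_le (erefl x)) _.
  by have := growth _ dy; have := growth _ dxt; lra.
have k0 : 0 <= 1 / (4 * L) + 2 * tau / mu.
  by rewrite addr_ge0 // divr_ge0 // ?mulr_ge0 // ltW.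
rewrite thetaE'.
apply: le_trans (noise_absorbed tau_gt0 tau_le L_gt0 mu_gt0 mu_tauL tau2L
  (dot_ge0 _) (dot_ge0 _) Dle).
apply: le_trans (lerD (lexx _) (ler_wpM2l k0 (avg_noise_le xt x))).
rewrite -avgZ -[X in X + avg _](avg_cst _ card_draw_gt0) -avgD.
apply: ler_avg => d; have [_ _] := step_properties d dxt dy dz.
by rewrite (mulrC (1 + tau / 6)) divfK // -thetaE' gt_eqF.
Qed.

Lemma outer_stepE : outer_step F G h L theta alpha tau tau (m := m) (A := A) (B := B) (C := C)
  = nested_outer step theta (m := m).
Proof. by apply/funext => -[xt yz]; apply/funext. Qed.

(** The constant 12 is 6 divided by 1/2: the initial potential is at most (51/88 + 1 + 7/2) a(x0) <=
    6 a(x0), and the weight p Theta of the output is at least 1/2. *)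
Lemma sock_avg_gap_le S x0 : dom x0 ->
  (forall w : run_draws n1 n2 A B C m S,
     dom (sock F G h L theta alpha tau tau x0 w)) /\
  avg (fun w : run_draws n1 n2 A B C m S => a (sock F G h L theta alpha tau tau x0 w))
  <= 12 * (12 / 13) ^+ S * a x0.
Proof.
move=> dx0.
set p := 17 / 16 * tau; set beta := 1 - 31 / 16 * tau.
set gam := tau * (3 / 2 * tau * L + mu / 2) / theta.
pose Theta := \sum_(j < m) theta ^+ j.
have p0 : 0 <= p by rewrite mulr_ge0 // ltW.
have b0 : 0 <= beta by rewrite /beta; move: tau_le; lra.
have k0 : 0 <= 3 / 2 * tau * L + mu / 2.
  by rewrite addr_ge0 ?divr_ge0 ?mulr_ge0 // ltW.
have g0 : 0 <= gam by rewrite divr_ge0 ?mulr_ge0 // ltW.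
(* To first order in tau this compares 12/11 * 17/16 = 51/44 with 31/16 - 1/6 = 85/48. *)
have bt : theta ^+ m * p <= 1 - beta * theta.
  apply: (le_trans (ler_wpM2r p0 theta_expm_le)); rewrite thetaE' /p /beta.
  by have := sqr_ge0 tau; move: tau_gt0; lra.
have rt : 1 <= 12 / 13 * theta ^+ m by have := theta_expm_ge; lra.
have a0 := gap_ge0 hproper dxs xsmin.
have dst0 : dom_state dom (x0, (x0, x0)) by split.
have sdom xt yz d : dom xt -> dom yz.1 -> dom yz.2 ->
    dom (step xt yz d).1 /\ dom (step xt yz d).2.
  by move=> dxt dy dz; have [] := step_properties d dxt dy dz.
have aconv t u v : dom u -> dom v -> 0 <= t -> t <= 1 ->
    dom (t *: u + (1 - t) *: v) /\ a (t *: u + (1 - t) *: v) <= t * a u + (1 - t) * a v.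
  exact: gap_convex.
have Hdom := nested_loop_dom m_gt0 theta_gt0 aconv sdom (S := S) _ dst0.
have Havg := nested_loop_avg card_draw_gt0 m_gt0 theta_gt0 p0 b0 g0 bt rt a0
  (fun u => dot_ge0 (u - xs)) aconv sdom step_avg_le S dst0.
rewrite /sock outer_stepE; split=> [w|]; first by case: (Hdom w).
rewrite -/Theta in Havg.
have Th1 : m%:R <= Theta.
  rewrite -[m in m%:R]card_ord -sumr_const; apply: ler_sum => j _; exact: exprn_ege1.
have Th2 : Theta <= m%:R * (12 / 11).
  apply: (le_trans (y := \sum_(j < m) theta ^+ m)).
    by apply: ler_sum => j _; apply: ler_weXn2l => //; exact: ltnW.
  by rewrite sumr_const card_ord -[theta ^+ m *+ m]mulr_natl ler_wpM2l // theta_expm_le.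
have pm : p * m%:R = 17 / 32 by rewrite /p -(mulrA _ tau) tau_m; field.
have pTh1 : 1 / 2 <= p * Theta.
  by have := ler_wpM2l p0 Th1; rewrite pm; lra.
have pTh2 : p * Theta <= 51 / 88.
  by have := ler_wpM2l p0 Th2; rewrite (mulrA p) pm; lra.
(* From tau^2 L <= mu and tau <= 1/2, gam <= 3/2 mu + 1/4 mu; quadratic growth contributes 2/mu. *)
have gd : gam * dist x0 <= 7 / 2 * a x0.
  have growth := quadratic_growth df fL fconvex hproper hconvex hmu mu_gt0 dxs xsmin dx0.
  apply: (le_trans (ler_wpM2l g0 growth)); rewrite mulrA ler_wpM2r ?a0 //.
  have gle : gam <= 7 / 4 * mu.
    rewrite /gam ler_pdivrMr //; apply: (le_trans (y := 7 / 4 * mu)); last first.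
      by rewrite ler_peMr // mulr_ge0 // ltW.
    by have := ler_wpM2r (ltW mu_gt0) tau_le; move: tau2L; lra.
  apply: (le_trans (ler_wpM2r _ gle)); first by rewrite divr_ge0 // ltW.
  by rewrite le_eqVlt; apply/orP; left; apply/eqP; field; rewrite gt_eqF.
have Q0 : 0 <= avg (fun w : S.-tuple (m.-tuple (draw n1 n2 A B C)) =>
    a (foldl (nested_outer step theta (m := m)) (x0, (x0, x0)) w).1).
  rewrite -[leLHS](avg_cst 0 (card_tuple_gt0 S (card_tuple_gt0 m card_draw_gt0))).
  by apply: ler_avg => w; apply: a0; case: (Hdom w).
have Phi0 : potential a (fun u => dist u) theta p beta gam m (x0, (x0, x0)) <= 6 * a x0.
  rewrite /potential -/Theta /=.
  have := ler_wpM2r (a0 _ dx0) pTh2.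
  have tax := mulr_ge0 (ltW tau_gt0) (a0 _ dx0).
  by have := a0 _ dx0; move: gd tax; rewrite /beta; lra.
have r0 : 0 <= (12 / 13) ^+ S :> R by rewrite exprn_ge0 // divr_ge0.
have := le_trans Havg (ler_wpM2l r0 Phi0).
have := ler_wpM2r Q0 pTh1.
move: (avg _) ((12 / 13) ^+ S) => q r H1 H2.
have := le_trans H1 H2; lra.
Qed.

End SoCKConvergence.

(** * Rounding up the sample sizes and loop lengths *)

Section Rounding.
Context {R : realType}.
Implicit Types (r : R).

Lemma ceiln_natr r : 0 <= r -> (ceiln r)%:R = (Num.ceil r)%:~R :> R.
Proof.
move=> r0; rewrite /ceiln natr_absz ger0_norm //.
by rewrite ceil_ge0 (lt_le_trans _ r0) // ltrN10.
Qed.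

Lemma ceiln_ge r : 0 <= r -> r <= (ceiln r)%:R.
Proof. by move=> r0; rewrite ceiln_natr // ceil_ge. Qed.

Lemma ceiln_lt r : 0 <= r -> (ceiln r)%:R < r + 1.
Proof.
move=> r0; rewrite ceiln_natr //; have := ceilB1_lt r.
by rewrite rmorphB /= ltrBlDr.
Qed.

Lemma maxn1_ceiln_ge r : 0 <= r -> r <= (maxn 1 (ceiln r))%:R.
Proof.
by move=> r0; apply: le_trans (ceiln_ge r0) _; rewrite ler_nat leq_maxr.
Qed.

Lemma maxn1_ceiln_le r : 0 <= r -> (maxn 1 (ceiln r))%:R <= r + 1.
Proof.
move=> r0; rewrite /maxn; case: ifP => _; first exact: ltW (ceiln_lt r0).
by rewrite lerDr.
Qed.

(** Since M >= 1, the at most 1 lost by rounding is absorbed as one more multiple of M. *)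
Lemma sample_size_le (c x y M : R) : 0 <= c -> 0 <= x -> 0 <= y -> x * y <= M -> 1 <= M ->
  (maxn 1 (ceiln (c * x * y)))%:R <= (c + 1) * M.
Proof.
move=> c0 x0 y0 xyM M1; have cxy0 : 0 <= c * x * y by rewrite !mulr_ge0.
apply: le_trans (maxn1_ceiln_le cxy0) _; rewrite -mulrA.
by have := ler_wpM2l c0 xyM; lra.
Qed.

Lemma ceiln_scale_le (c x : R) : 0 <= c -> 1 <= x -> (ceiln (c * x))%:R <= (c + 1) * x.
Proof.
move=> c0 x1; have cx0 : 0 <= c * x by rewrite mulr_ge0 // (le_trans ler01).
by apply: le_trans (ltW (ceiln_lt cx0)) _; lra.
Qed.

Lemma total_sample_size_le (a b c M : R) : 1 <= M ->
  a <= (2160 + 1) * M -> b <= (2160 + 1) * M -> c <= (1080 + 1) * M ->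
  2 * (a + b + c) + 2 <= 10808 * M.
Proof. lra. Qed.

Lemma total_sample_size_const : 3 / 2 * 10808 <= 100 * 200 :> R.
Proof. lra. Qed.

End Rounding.

(** * The inner loop length is of the order of the square root of L/mu *)

Section InnerLoopLength.
Context {R : realType}.
Variables (L mu : R).
Hypotheses (mu_gt0 : 0 < mu) (muL : mu <= L).
Let q := Num.sqrt (L / mu).
Let m := ceiln (2^-1 * q).
Let tau : R := (2 * m%:R)^-1.

Let q_ge1 : 1 <= q.
Proof.
have : Num.sqrt 1 <= q by apply: ler_wsqrtr; rewrite ler_pdivlMr // mul1r.
by rewrite sqrtr1.
Qed.

Let Lq : L = mu * q ^+ 2.
Proof.
rewrite sqr_sqrtr ?divr_ge0 ?ltW ?(lt_le_trans mu_gt0) //.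
by rewrite mulrC divfK // gt_eqF.
Qed.

Let q2_ge0 : 0 <= 2^-1 * q.
Proof. by rewrite mulr_ge0 ?invr_ge0 // (le_trans ler01). Qed.

Lemma inner_length_gt0 : (0 < m)%N.
Proof.
rewrite -(ltr0n R); apply: lt_le_trans (ceiln_ge q2_ge0).
by rewrite mulr_gt0 ?invr_gt0 // (lt_le_trans ltr01).
Qed.

Lemma inner_length_le : m%:R <= 3 / 2 * q.
Proof. by have := ceiln_lt q2_ge0; rewrite -/m; move: q_ge1; lra. Qed.

Let m2_gt0 : 0 < 2 * m%:R :> R.
Proof. by rewrite mulr_gt0 // ltr0n inner_length_gt0. Qed.

(** The inner loop is long enough: 2m >= q. *)
Lemma tau_sqr_le : tau ^+ 2 * L <= mu.
Proof.
rewrite /tau exprVn mulrC ler_pdivrMr ?exprn_gt0 // Lq ler_pM2l //.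
apply: lerXn2r; rewrite ?nnegrE ?(ltW m2_gt0) ?(le_trans ler01 q_ge1) //.
by have := ceiln_ge q2_ge0; rewrite -/m; lra.
Qed.

(** The inner loop is not too long: 2m <= 3q <= 3 q^2. *)
Lemma mu_le_tau : mu <= 3 * tau * L.
Proof.
rewrite /tau mulrAC ler_pdivlMr // Lq.
have H : 2 * m%:R <= 3 * q by have := inner_length_le; lra.
have H2 : q <= q ^+ 2 by rewrite expr2 ler_peMr // (le_trans ler01).
have := ler_wpM2l (ltW mu_gt0) H; have := ler_wpM2l (ltW mu_gt0) H2; lra.
Qed.

Lemma sqrt_cond_ge1 : 1 <= q. Proof. exact: q_ge1. Qed.

End InnerLoopLength.

(** * Number of outer loops and total cost *)

Section OuterLoops.
Context {R : realType}.

(** As 12/13 <= exp(-1/13), 65 Lambda loops contract by exp(-5 Lambda). One factor exp(Lambda)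
    bounds Delta/eps, and the remaining exp(4 Lambda) >= 2^4 outweighs 12. *)
Lemma outer_loops_suffice (Delta eps Lambda : R) (S : nat) : 0 < eps -> 1 <= Lambda ->
  ln (Delta / eps) <= Lambda -> 65 * Lambda <= S%:R -> 12 * (12 / 13) ^+ S * Delta <= eps.
Proof.
move=> eps0 L1 lnL SL.
have r0 : 0 <= (12 / 13) ^+ S :> R by rewrite exprn_ge0 // divr_ge0.
(* For Delta <= 0 the logarithm carries no information, but the left-hand side is then
   nonpositive. *)
have [D0|D0] := leP Delta 0.
  by apply: le_trans (ltW eps0); rewrite mulr_ge0_le0 // mulr_ge0.
have r_le : (12 / 13) ^+ S <= expR (- (5 * Lambda)) :> R.
  apply: (le_trans (y := expR (- 1 / 13) ^+ S)).
    apply: lerXn2r; rewrite ?nnegrE ?expR_ge0 ?divr_ge0 //.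
    by apply: le_trans (expR_ge1Dx _); lra.
  by rewrite -expRM_natl ler_expR; move: SL; lra.
have D_le : Delta <= eps * expR Lambda.
  rewrite mulrC -ler_pdivrMr // -[leLHS]lnK ?posrE ?divr_gt0 //.
  by rewrite ler_expR.
have e1 : 2 <= expR Lambda by apply: le_trans (expR_ge1Dx _); lra.
have e4 : 16 <= expR Lambda ^+ 4.
  have -> : 16 = 2 ^+ 4 :> R by rewrite -natrX.
  by apply: lerXn2r; rewrite ?nnegrE ?expR_ge0.
have E : expR (- (5 * Lambda)) * expR Lambda * expR Lambda ^+ 4 = 1.
  by rewrite -expRM_natl -!expRD -[RHS]expR0; congr expR; ring.
have H : 12 * (12 / 13) ^+ S * Delta <=
    12 * expR (- (5 * Lambda)) * (eps * expR Lambda).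
  by apply: ler_pM; [exact: mulr_ge0 | exact: ltW | rewrite ler_pM2l | exact: D_le].
apply: le_trans H _.
set u := expR (- (5 * Lambda)) in E *; set v := expR Lambda in E e4 e1 *.
have uv0 : 0 <= u * v by rewrite mulr_ge0 ?expR_ge0.
have H := ler_wpM2l uv0 e4; rewrite E in H.
have H2 : 12 * (u * v) <= 1 by move: uv0 H; lra.
by have := ler_wpM2l (ltW eps0) H2; lra.
Qed.

(** W is the cost of one inner iteration; K dominates both the 2 in front of n2 and the factor 3/2 k
    of the square-root term. *)
Lemma complexity_arith (n1 n2 m W S q M Lam k K s : R) :
  0 <= n1 -> 0 <= n2 -> 0 <= m -> 0 <= W -> 0 <= q -> 0 <= M -> 0 <= Lam -> 0 <= s ->
  m <= 3 / 2 * q -> W <= k * M -> S <= s * Lam -> 2 <= K -> 3 / 2 * k <= K ->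
  S * (n1 + 2 * n2 + m * W) <= s * K * (n1 + n2 + q * M) * Lam.
Proof.
move=> n10 n20 m0 W0 q0 M0 L0 s0 mq WM SL K2 kK.
have qM0 : 0 <= q * M by exact: mulr_ge0.
have H : m * W <= K * (q * M).
  apply: (le_trans (y := 3 / 2 * q * (k * M))); first exact: ler_pM.
  by have := ler_wpM2r qM0 kK; lra.
have Y0 : 0 <= n1 + 2 * n2 + m * W by have := mulr_ge0 m0 W0; lra.
have H1 := ler_wpM2r n10 K2; have H2 := ler_wpM2r n20 K2.
have H3 : n1 + 2 * n2 + m * W <= K * (n1 + n2 + q * M) by lra.
apply: le_trans (ler_wpM2r Y0 SL) _.
by have := ler_wpM2l (mulr_ge0 s0 L0) H3; lra.
Qed.

End OuterLoops.

(** * Accuracy and complexity combined for the prescribed parameters *)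

Theorem corollary5p4 :
  exists c : nat,
  forall (R : realType) (N1 N2 n1 n2 : nat)
    (F : 'I_n1 -> 'rV[R]_N1 -> R) (G : 'I_n2 -> 'rV[R]_N2 -> 'rV[R]_N1)
    (h : 'rV[R]_N2 -> \bar R)
    (mu L LF BF LG BG eps : R) (x0 xstar : 'rV[R]_N2),
  (0 < n1)%N -> (0 < n2)%N ->
  (forall i x, differentiable (F i) x) ->
  (forall j x, differentiable (G j) x) ->
  proper_fun h -> closed_fun h -> convex_efun h ->
  convex_function setT (fcomp F G) ->
  0 < mu -> strongly_convex mu h ->
  (forall i, smooth_fun LF (F i)) -> (forall i, bounded_gradient BF (F i)) ->
  (forall j, smooth_map LG (G j)) -> (forall j, bounded_Jac BG (G j)) ->
  (forall i j x y,
     enorm (gradient (F i) (Gavg G x) *m Jac (G j) x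
            - gradient (F i) (Gavg G y) *m Jac (G j) y) <= L * enorm (x - y)) ->
  mu <= L ->
  is_minimizer (Hobj F G h) xstar ->
  0 < eps ->
  (h x0 < +oo)%E ->
  let m := ceiln (2^-1 * Num.sqrt (L / mu)) in
  let tau1 : R := (2 * m%:R)^-1 in
  let tau2 : R := (2 * m%:R)^-1 in
  let theta : R := 1 + (12 * m%:R)^-1 in
  let alpha : R := (3 * tau1 * L)^-1 in
  let A := maxn 1 (ceiln (2160 * BG ^+ 4 * LF ^+ 2 / mu ^+ 2)) in
  let B := maxn 1 (ceiln (2160 * BF ^+ 2 * LG ^+ 2 / mu ^+ 2)) in
  let C := maxn 1 (ceiln (1080 * L ^+ 2 / mu ^+ 2)) in
  exists S : nat,
    [/\ (0 < S)%N,
        (unif_expectation (fun w : run_draws n1 n2 A B C m S =>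
           Hobj F G h (sock F G h L theta alpha tau1 tau2 x0 w)
           - Hobj F G h xstar) <= eps%:E)%E
      & (sock_complexity n1 n2 m A B C S)%:R <=
          c%:R
          * (n1%:R + n2%:R
             + Num.sqrt (L / mu)
               * (Num.max (BG ^+ 4 * LF ^+ 2)
                    (Num.max (BF ^+ 2 * LG ^+ 2) (L ^+ 2)) / mu ^+ 2))
          * Num.max 1
              (ln ((fine (Hobj F G h x0) - fine (Hobj F G h xstar)) / eps))].
Proof.
(* 66 bounds the number of outer loops per unit of the logarithm, 65 plus rounding; 100 * 200 bounds
   the cost of one loop, 3/2 * 10808. *)
exists (66 * (100 * 200))%N => R N1 N2 n1 n2 F G h mu L LF BF LG BG eps x0 xs.
move=> n1_gt0 n2_gt0 dF dG hproper hclosed hconvex fconvex mu_gt0 hmu hLF hBF hLG hBG hL.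
move=> muL xsmin eps_gt0 dx0 m tau1 tau2 theta alpha A B C.
have L_gt0 : 0 < L by exact: lt_le_trans muL.
have dxs : (h xs < +oo)%E.
  have := xsmin x0; rewrite /Hobj (proper_fineK hproper dx0) -EFinD.
  by case: (h xs) => [r _||_]; rewrite ?ltry ?ltNyr // addey // leye_eq.
pose f := fcomp F G.
have m_gt0 : (0 < m)%N := inner_length_gt0 mu_gt0 muL.
have BG4 : 0 <= BG ^+ 4 by exact: exprn_even_ge0.
have A0 := divr_ge0 (mulr_ge0 (mulr_ge0 (ler0n R 2160) BG4) (sqr_ge0 LF)) (sqr_ge0 mu).
have B0 := divr_ge0 (mulr_ge0 (mulr_ge0 (ler0n R 2160) (sqr_ge0 BF)) (sqr_ge0 LG)) (sqr_ge0 mu).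
have C0 := divr_ge0 (mulr_ge0 (ler0n R 1080) (sqr_ge0 L)) (sqr_ge0 mu).
set Lam := Num.max 1 _.
have Lam1 : 1 <= Lam by rewrite /Lam le_max lexx.
have Lam65 : 0 <= 65 * Lam by rewrite mulr_ge0 // (le_trans ler01).
pose S := ceiln (65 * Lam).
have SL : 65 * Lam <= S%:R := ceiln_ge Lam65.
have [sdom savg] := sock_avg_gap_le n1_gt0 n2_gt0 dF dG hproper hclosed hconvex fconvex
  mu_gt0 hmu hLF hBF hLG hBG hL L_gt0 xsmin dxs m_gt0
  (leq_maxl 1 _ : (0 < A)%N) (leq_maxl 1 _ : (0 < B)%N) (leq_maxl 1 _ : (0 < C)%N)
  (erefl tau1) (erefl theta) (erefl alpha) (mu_le_tau mu_gt0 muL) (tau_sqr_le mu_gt0 muL)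
  (maxn1_ceiln_ge A0) (maxn1_ceiln_ge B0) (maxn1_ceiln_ge C0) S dx0.
have HobjE u : (h u < +oo)%E -> Hobj F G h u = (f u + fine (h u))%:E.
  by move=> du; rewrite /Hobj {1}(proper_fineK hproper du) EFinD.
exists S; split.
- by rewrite -(ltr0n R); apply: lt_le_trans SL; rewrite mulr_gt0 // (lt_le_trans ltr01).
- rewrite /unif_expectation.
  (* Every output has a finite value of h, so the extended-real expectation is a real mean. *)
  under eq_bigr => w _ do rewrite (HobjE _ (sdom w)) (HobjE _ dxs) -EFinB.
  rewrite sumEFin -EFinM lee_fin; apply: le_trans savg _.
  apply: (outer_loops_suffice eps_gt0 Lam1 _ SL).
  by rewrite /Lam (HobjE _ dx0) (HobjE _ dxs) /= le_max lexx orbT.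
- set X := Num.max (BG ^+ 4 * LF ^+ 2) _.
  have M_ge Y : Y <= X -> Y / mu ^+ 2 <= X / mu ^+ 2.
    by move=> YX; apply: ler_wpM2r; rewrite ?invr_ge0 ?sqr_ge0.
  have MA : BG ^+ 4 * LF ^+ 2 / mu ^+ 2 <= X / mu ^+ 2.
    by apply: M_ge; rewrite le_max lexx.
  have MB : BF ^+ 2 * LG ^+ 2 / mu ^+ 2 <= X / mu ^+ 2.
    by apply: M_ge; rewrite !le_max lexx orbT.
  have MC : L ^+ 2 / mu ^+ 2 <= X / mu ^+ 2.
    by apply: M_ge; rewrite !le_max lexx !orbT.
  move: MA MB MC; clear M_ge; move: (X / mu ^+ 2) => M MA MB MC.
  (* This follows from mu <= L and lets M absorb the rounding of A, B and C. *)
  have M1 : 1 <= M.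
    apply: le_trans MC; rewrite ler_pdivlMr ?exprn_gt0 // mul1r.
    by apply: lerXn2r; rewrite ?nnegrE ?(ltW mu_gt0) ?(ltW L_gt0).
  have mu2 : 0 <= (mu ^+ 2)^-1 by rewrite invr_ge0 sqr_ge0.
  have AM : A%:R <= (2160 + 1) * M.
    rewrite /A -(mulrA (2160 : R)).
    exact: (sample_size_le (ler0n R 2160) (mulr_ge0 BG4 (sqr_ge0 LF)) mu2 MA M1).
  have BM : B%:R <= (2160 + 1) * M.
    rewrite /B -(mulrA (2160 : R)).
    exact: (sample_size_le (ler0n R 2160) (mulr_ge0 (sqr_ge0 BF) (sqr_ge0 LG)) mu2 MB M1).
  have CM : C%:R <= (1080 + 1) * M.
    exact: (sample_size_le (ler0n R 1080) (sqr_ge0 L) mu2 MC M1).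
  have S66 : S%:R <= 66 * Lam.
    by have := ceiln_scale_le (ler0n R 65) Lam1; rewrite natr1.
  have W0 : 0 <= 2 * (A%:R + B%:R + C%:R) + 2 :> R.
    by rewrite addr_ge0 ?ler0n // mulr_ge0 ?ler0n // !addr_ge0 ?ler0n.
  have WM := total_sample_size_le M1 AM BM CM.
  have K2 : 2 <= 100 * 200 :> R by rewrite -natrM ler_nat.
  have q1 := sqrt_cond_ge1 mu_gt0 muL.
  have H := complexity_arith (ler0n R n1) (ler0n R n2) (ler0n R m) W0 (le_trans ler01 q1)
    (le_trans ler01 M1) (le_trans ler01 Lam1) (ler0n R 66) (inner_length_le mu_gt0 muL)
    WM S66 K2 total_sample_size_const.
  rewrite /sock_complexity !sum_nat_const !card_ord.
  clearbody A B C m S.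
  rewrite (natrM R S) (natrD R (n1 + 2 * n2)) (natrD R n1) (natrM R 2 n2) (natrM R m).
  rewrite (natrD R (2 * _)) (natrM R 2) (natrD R (A + B)) (natrD R A).
  by rewrite (natrM R 66) (natrM R 100).
Qed.
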